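(* Let $\theta>0$ and $\alpha>-1$ be real. For every $n=1,2,\ldots$ and all $x_1,\ldots,x_n\in(0,+\infty)$ the following limit exists and has the indicated value: $$\lim_{N\to\infty}\frac{1}{N^{n(1+\frac1\theta)}}\,\rho^{Jac}_{nN}\left(\frac{x_1}{N^{1+\frac1\theta}},\ldots,\frac{x_n}{N^{1+\frac1\theta}}\right)=\prod_{i=1}^n x_i^{\alpha}\cdot\det\left[\mathcal K^{(\alpha,\theta)}(x_i,x_j)\right]_{i,j=1}^n,$$ where $$\mathcal K^{(\alpha,\theta)}(x,y)=\sum_{k,l=0}^{\infty}\frac{(-1)^{k}x^{k}}{k!\,\Gamma\left(\frac{\alpha+1+k}{\theta}\right)}\,\frac{(-1)^l y^{\theta l}}{l!\,\Gamma(\alpha+1+\theta l)}\,\frac{\theta}{\alpha+1+k+\theta l}=\theta\int_0^1 J_{\frac{\alpha+1}{\theta},\frac1\theta}(xt)\,J_{\alpha+1,\theta}\left((yt)^{\theta}\right)t^{\alpha}\,dt .$$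
   Context: Biorthogonal Jacobi ensemble: for $N\ge1$, the $N$-point ensemble on $(0,1)$ with joint probability density $$p^{Jac}_N(x_1,\ldots,x_N)=\mathrm{const}\cdot\prod_{i=1}^N x_i^{\alpha}\prod_{1\le i<j\le N}\left[(x_i-x_j)(x_i^{\theta}-x_j^{\theta})\right],$$ where the constant is chosen so that the total integral over $(0,1)^N$ is $1$. For $n\le N$ its $n$-th correlation function is $$\rho^{Jac}_{nN}(x_1,\ldots,x_n)=\frac{N!}{(N-n)!}\int_{(0,1)^{N-n}}p^{Jac}_N(x_1,\ldots,x_N)\,dx_{n+1}\cdots dx_N .$$ Wright's generalized Bessel function, for $a,b>0$, is $J_{a,b}(x)=\sum_{m=0}^{\infty}\frac{(-x)^m}{m!\,\Gamma(a+bm)}$. *)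

(* Defs.v *)
From mathcomp Require Import all_boot all_order all_algebra.
From mathcomp Require Import all_classical all_reals all_analysis.

Set Implicit Arguments.
Unset Strict Implicit.
Unset Printing Implicit Defensive.

Import Order.TTheory GRing.Theory Num.Theory.
Import numFieldNormedType.Exports.

Local Open Scope classical_set_scope.
Local Open Scope ring_scope.

(* Euler's integral; only meaningful for s > 0, and only used there. *)
Definition Gamma {R : realType} (s : R) : R :=
  \int[lebesgue_measure]_(t in `]0, +oo[) (t `^ (s - 1) * expR (- t)).

(* Integral of F(y_1, ..., y_m) dy_1 ... dy_m over (0,1)^m, as an iterated
   Lebesgue integral.  It is only applied to nonnegative measurable F, for which
   it is the integral against m-dimensional Lebesgue measure by Tonelli. *)
Fixpoint cube_integral {R : realType} (m : nat) (F : seq R -> \bar R) : \bar R :=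
  if m is m'.+1 then
    (\int[lebesgue_measure]_(t in `]0%R, 1%R[)
       cube_integral m' (fun s => F (t :: s)))%E
  else F [::].

Section jacobi_ensemble.
Context {R : realType}.
Variables alpha theta : R.

(* Points of (0,1)^N are sequences of size N. *)
Definition jac_weight (N : nat) (x : seq R) : R :=
  (\prod_(i < N) x`_i `^ alpha) *
  \prod_(i < N) \prod_(j < N | (i < j)%N)
    ((x`_i - x`_j) * (x`_i `^ theta - x`_j `^ theta)).

Definition jac_partition (N : nat) : R :=
  fine (cube_integral N (fun x => (jac_weight N x)%:E)).

Definition jac_density (N : nat) (x : seq R) : R :=
  (jac_partition N)^-1 * jac_weight N x.

(* Meaningful for n <= N. *)
Definition jac_corr (n N : nat) (x : n.-tuple R) : R :=
  N`!%:R / (N - n)`!%:R *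
  fine (cube_integral (N - n) (fun y => (jac_density N (x ++ y))%:E)).

End jacobi_ensemble.

Definition wrightJ {R : realType} (a b x : R) : R :=
  limn (series (fun m : nat => (- x) ^+ m / (m`!%:R * Gamma (a + b * m%:R)))).

Section limit_kernel.
Context {R : realType}.
Variables alpha theta : R.

Definition kernel_term (x y : R) (k l : nat) : R :=
  (-1) ^+ k * x ^+ k / (k`!%:R * Gamma ((alpha + 1 + k%:R) / theta)) *
  ((-1) ^+ l * y `^ (theta * l%:R) /
     (l`!%:R * Gamma (alpha + 1 + theta * l%:R))) *
  (theta / (alpha + 1 + k%:R + theta * l%:R)).

(* Double series, summed iteratedly; the order is immaterial when the family
   [kernel_term x y] is absolutely summable over nat * nat. *)
Definition limit_kernel (x y : R) : R :=
  limn (series (fun k : nat => limn (series (kernel_term x y k)))).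

End limit_kernel.

(* Main.v *)
Require Import Defs.
From mathcomp Require Import all_boot all_order all_algebra.
From mathcomp Require Import all_classical all_reals all_analysis.
From mathcomp Require Import measurable_realfun.
From mathcomp Require Import ring lra.

Set Implicit Arguments.
Unset Strict Implicit.
Unset Printing Implicit Defensive.

Import Order.TTheory GRing.Theory Num.Theory.
Import numFieldNormedType.Exports.

Local Open Scope classical_set_scope.
Local Open Scope ring_scope.

(** Why the theorem holds.

    The weight is, up to its monomial prefactor, the product of two Vandermonde
    determinants, one in the x_i and one in the x_i^theta.  Inserting between
    them the inverse C of the moment matrix
      int_0^1 t^k t^(theta l) t^alpha dt = 1 / (k + alpha + 1 + theta l)
    turns it into det [K_N (x_i, x_j)] / det C, where
      K_N (x, y) = sum_(k, l < N) C_(k, l) x^k y^(theta l)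
    (jac_kernel).  Since C inverts the moments, K_N reproduces itself under
    integration against t^alpha and has trace N.  Hence integrating out one
    point of an (n+1)-point determinant gives (N - n) times the n-point
    determinant (int01_det_rcons), and iterating yields
      rho_n (x) = prod x_i^alpha * det [K_N (x_i, x_j)]_(i, j <= n)
    for every n <= N (jac_corrE).

    The moment matrix is a Cauchy matrix, so C is explicit (sum_cauchy_inv):
    its entries are products of factors s (s + 1) ... (s + N - 1), with
    s = (alpha + 1 + k) / theta or s = alpha + 1 + theta l.  Divided by
    (N - 1)! N^s such a product tends to 1 / Gamma s (Euler), so at the scale
    x / N^(1 + 1 / theta) all powers of N cancel and each term of the double
    sum K_N tends to the corresponding term of the limit kernel
    (jac_kernel_scaled).

    To exchange limit and sum, the Euler products are bounded by s e^s
    uniformly in N (euler_ratio_le).  This is only exponential in k and l, and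
    the factors 1 / (k! l!) leave a summable majorant of product form; Tannery's
    theorem then gives the limit of K_N, and continuity of the determinant that
    of the correlation functions.  The same majorant gives the absolute
    summability of the double series and, by dominated convergence on (0, 1)
    applied to square partial sums, its integral representation.

    Euler's limit is obtained from two properties of the Gamma integral: the
    functional equation (GammaS, by parts) and the one-sided estimate
    Gamma (p + r) <= p^r Gamma p for 0 <= r <= 1 (Gamma_addr_le), whose use at
    p = N and at p = N + s squeezes Gamma (N + s) / (Gamma N * N^s). *)

(** * Bordered determinants and the inverse of a Cauchy matrix *)

Section bordered_determinant.

(** Multiply by the block upper triangular matrix with diagonal blocks adj A and
    det A; the product is block lower triangular, and the common factor
    (det A)^n cancels. *)
Let det_bordered_neq0 (F : idomainType) n (A : 'M[F]_n) (u : 'cV[F]_n)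
    (v : 'rV[F]_n) (c : F) : \det A != 0 ->
  \det (block_mx A u v c%:M) = c * \det A - (v *m \adj A *m u) 0 0.
Proof.
move=> A0; set D := \det _; set d := \det A.
have eqM : block_mx A u v c%:M *m block_mx (\adj A) (- (\adj A *m u)) 0 d%:M =
    block_mx d%:M 0 (v *m \adj A) (c * d - (v *m \adj A *m u) 0 0)%:M.
  rewrite mulmx_block !mulmx0 !addr0 mul_mx_adj; congr block_mx.
    rewrite mulmxN mulmxA mul_mx_adj mul_scalar_mx mul_mx_scalar.
    by rewrite addNr.
  rewrite mulmxN mulmxA -scalar_mxM addrC; set w := _ *m _.
  by apply/matrixP => i j; rewrite !ord1 !mxE eqxx !mulr1n.
have /(congr1 (@determinant _ _)) := eqM.
rewrite det_mulmx det_ublock det_lblock !det_scalar expr1 -/D.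
have dadj : d * \det (\adj A) = d ^+ n by rewrite -det_mulmx mul_mx_adj det_scalar.
rewrite [_ * d]mulrC dadj [D * _]mulrC => /mulfI; apply.
by rewrite expf_neq0.
Qed.

(** A polynomial identity in the entries of A, so it suffices to have it for
    'X + A over the polynomial ring, whose determinant is monic, hence nonzero;
    then specialize 'X to 0. *)
Lemma det_bordered (F : idomainType) n (A : 'M[F]_n) (u : 'cV[F]_n)
    (v : 'rV[F]_n) (c : F) :
  \det (block_mx A u v c%:M) = c * \det A - (v *m \adj A *m u) 0 0.
Proof.
pose ev : {rmorphism {poly F} -> F} := horner_eval (0 : F).
pose A' : 'M[{poly F}]_n := 'X%:M + map_mx polyC A.
have evC m k (M : 'M[F]_(m, k)) : map_mx ev (map_mx polyC M) = M.
  by apply/matrixP => i j; rewrite !mxE /= /horner_eval hornerC.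
have evA : map_mx ev A' = A.
  rewrite map_mxD evC map_scalar_mx /= /horner_eval hornerX.
  by rewrite (raddf0 scalar_mx) add0r.
have A'0 : \det A' != 0.
  have -> : \det A' = char_poly (- A).
    by rewrite /char_poly /char_poly_mx map_mxN opprK.
  by rewrite monic_neq0// char_poly_monic.
have := det_bordered_neq0 (map_mx polyC u) (map_mx polyC v) c%:P A'0.
move=> /(congr1 ev); rewrite -det_map_mx map_block_mx evA !evC map_scalar_mx.
rewrite rmorphB rmorphM -det_map_mx evA.
have evE (M : 'M[{poly F}]_1) : ev (M 0 0) = map_mx ev M 0 0 by rewrite mxE.
rewrite evE !map_mxM map_mx_adj evA !evC.
by have -> : ev c%:P = c by rewrite /= /horner_eval hornerC.
Qed.

End bordered_determinant.

Section Cauchy_inverse.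
Variables (F : fieldType) (n : nat) (a b : 'I_n -> F).
Hypothesis b_inj : injective b.

Lemma Lagrange_interpolation (q : {poly F}) (x : F) : (size q <= n)%N ->
  q.[x] = \sum_l q.[b l] * \prod_(m | m != l) ((x - b m) / (b l - b m)).
Proof.
move=> szq.
pose L l : {poly F} := (\prod_(m | m != l) (b l - b m))^-1 *:
  \prod_(m | m != l) ('X - (b m)%:P).
have LE l y : (L l).[y] = \prod_(m | m != l) ((y - b m) / (b l - b m)).
  rewrite hornerZ horner_prod prodf_div mulrC; congr (_ / _).
  by apply: eq_bigr => m _; rewrite hornerXsubC.
have szL l : (size (L l) <= n)%N.
  rewrite (leq_trans (size_scale_leq _ _))//.
  rewrite -big_enum/= size_prod_XsubC -cardE cardC1 card_ord prednK//.
  exact: leq_ltn_trans (ltn_ord l).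
have Lb l m : (L l).[b m] = (l == m)%:R.
  rewrite LE; case: eqVneq => [->|lm].
    by rewrite big1// => i im; rewrite divff// subr_eq0 (inj_eq b_inj) eq_sym.
  by rewrite (bigD1 m) 1?eq_sym//= subrr !mul0r.
transitivity (\sum_l q.[b l] *: L l).[x]; last first.
  by rewrite horner_sum; apply: eq_bigr => l _; rewrite hornerZ LE.
congr (_.[x]); apply/eqP; rewrite -subr_eq0; apply/eqP.
apply: (@roots_geq_poly_eq0 _ _ [seq b l | l <- enum 'I_n]).
- apply/allP => _ /mapP[l _ ->]; rewrite rootE hornerD hornerN horner_sum.
  rewrite (bigD1 l)//= hornerZ Lb eqxx mulr1 big1 ?addr0 ?subrr// => m ml.
  by rewrite hornerZ Lb (negbTE ml) mulr0.
- by rewrite map_inj_uniq ?enum_uniq.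
- rewrite size_map size_enum_ord (leq_trans (size_polyD _ _))// geq_max szq.
  rewrite size_polyN (leq_trans (size_sum _ _ _))//; apply/bigmax_leqP => l _.
  exact: leq_trans (size_scale_leq _ _) (szL l).
Qed.

(** The classical closed form of the inverse of the matrix 1 / (a_k + b_l). *)
Definition cauchy_inv k l : F :=
  (\prod_m (a k + b m)) / (\prod_(m | m != k) (a k - a m)) *
  ((\prod_m (a m + b l)) / \prod_(m | m != l) (b l - b m)) / (a k + b l).

Hypothesis a_inj : injective a.
Hypothesis ab_neq0 : forall k l, a k + b l != 0.

(** Lagrange interpolation at the nodes b_l of the polynomial
    prod_(m != k) (a_m + X), evaluated at - a_i: that value vanishes unless
    i = k, and the interpolation weights are the inverse entries up to a factor
    depending only on i and k. *)
Lemma sum_cauchy_inv k i : \sum_l cauchy_inv k l / (a i + b l) = (k == i)%:R.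
Proof.
pose sg : F := (-1) ^+ n.-1.
have prodN j (f : 'I_n -> F) :
    \prod_(m | m != j) - f m = sg * \prod_(m | m != j) f m.
  by rewrite prodrN cardC1 card_ord.
have sg2 : sg * sg = 1 by rewrite -exprD addnn -signr_odd odd_double.
pose q : {poly F} := \prod_(m | m != k) ('X - (- a m)%:P).
have qE x : q.[x] = \prod_(m | m != k) (a m + x).
  rewrite horner_prod; apply: eq_bigr => m _.
  by rewrite hornerXsubC opprK addrC.
have szq : (size q <= n)%N.
  rewrite /q -big_enum/= size_prod_XsubC -cardE cardC1 card_ord prednK//.
  exact: leq_ltn_trans (ltn_ord k).
have := Lagrange_interpolation (- a i) szq; rewrite qE => interp.
pose P j := \prod_m (a j + b m).
have P0 j : P j != 0 by apply/prodf_neq0 => m _.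
have Dk0 : \prod_(m | m != k) (a k - a m) != 0.
  by apply/prodf_neq0 => m mk; rewrite subr_eq0 (inj_eq a_inj) eq_sym.
have Db0 l : \prod_(m | m != l) (b l - b m) != 0.
  by apply/prodf_neq0 => m ml; rewrite subr_eq0 (inj_eq b_inj) eq_sym.
transitivity (P k / (\prod_(m | m != k) (a k - a m)) / P i * sg *
    (\prod_(m | m != k) (a m - a i))).
  rewrite interp mulr_sumr; apply: eq_bigr => l _.
  rewrite qE prodf_div.
  under [X in _ = _ * (_ * (X / _))]eq_bigr do rewrite -opprD.
  rewrite prodN /cauchy_inv -/(P k).
  have -> : \prod_m (a m + b l) = (a k + b l) * \prod_(m | m != k) (a m + b l).
    by rewrite (bigD1 k).
  have -> : P i = (a i + b l) * \prod_(m | m != l) (a i + b m).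
    by rewrite /P (bigD1 l).
  set Q := \prod_(m | m != l) (a i + b m).
  have Q0 : Q != 0 by apply/prodf_neq0 => m _.
  rewrite [RHS](_ : _ = (sg * sg) * (P k / (\prod_(m | m != k) (a k - a m)) *
    (\prod_(m | m != k) (a m + b l) / \prod_(m | m != l) (b l - b m)) /
    (a i + b l))).
    rewrite sg2 mul1r; field; by rewrite Dk0 Db0 !ab_neq0.
  by field; rewrite Dk0 Db0 !ab_neq0.
have [<-|ki] := eqVneq k i.
  under [X in _ * X]eq_bigr do rewrite -opprB.
  rewrite prodN -[RHS]sg2; field.
  by rewrite P0 Dk0.
by rewrite [X in _ * X](bigD1 i) 1?eq_sym//= subrr mul0r mulr0.
Qed.

End Cauchy_inverse.

(** * Dominated convergence for series *)

Section Tannery.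
Context {R : realType}.
Implicit Types (u : nat -> nat -> R) (v g : nat -> R).

Lemma cvg_bigsum (I : Type) (r : seq I) (P : pred I) (f : I -> nat -> R)
    (l : I -> R) : (forall i, P i -> f i n @[n --> \oo] --> l i) ->
  \sum_(i <- r | P i) f i n @[n --> \oo] --> \sum_(i <- r | P i) l i.
Proof.
move=> fl; elim: r => [|i r IH].
  by under eq_fun do rewrite big_nil; rewrite big_nil; exact: cvg_cst.
under eq_fun do rewrite big_cons; rewrite big_cons.
by case: ifPn => // Pi; apply: cvgD => //; exact: fl.
Qed.

Lemma cvg_bigprod (I : Type) (r : seq I) (P : pred I) (f : I -> nat -> R)
    (l : I -> R) : (forall i, P i -> f i n @[n --> \oo] --> l i) ->
  \prod_(i <- r | P i) f i n @[n --> \oo] --> \prod_(i <- r | P i) l i.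
Proof.
move=> fl; elim: r => [|i r IH].
  by under eq_fun do rewrite big_nil; rewrite big_nil; exact: cvg_cst.
under eq_fun do rewrite big_cons; rewrite big_cons.
by case: ifPn => // Pi; apply: cvgM => //; exact: fl.
Qed.

Lemma dominated_series_cvg v g : (forall k, `|v k| <= g k) ->
  cvgn (series g) -> cvgn (series v).
Proof.
move=> vg cg; apply: normed_cvg.
by apply: series_le_cvg cg => // k; rewrite ?normr_ge0// (le_trans _ (vg k)).
Qed.

(** Dominated convergence for series, in the form where the partial sums are cut
    off at the same index that tends to infinity. *)
Lemma Tannery u v g : (forall k, u N k @[N --> \oo] --> v k) ->
  (forall N k, `|u N k| <= g k) -> cvgn (series g) ->
  \sum_(k < N.+1) u N k @[N --> \oo] --> limn (series v).
Proof.
move=> uv ug cg.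
have g0 k : 0 <= g k by exact: le_trans (ug 0%N k).
have vg k : `|v k| <= g k.
  by apply: (cvgr_to_le (cvg_norm (uv k))); near=> N; exact: ug.
have cv := dominated_series_cvg vg cg.
apply/cvgrPdist_le => e e0.
have e30 : 0 < e / 3 by rewrite divr_gt0.
(* From M on, the tails of both series g and v are below e / 3. *)
have [M _ hM] : \forall M \near \oo, `|limn (series g) - series g M| <= e / 3 /\
    `|limn (series v) - series v M| <= e / 3.
  near=> M; split; near: M.
    by have /cvgrPdist_le := cg; exact.
  by have /cvgrPdist_le := cv; exact.
have {hM} [gM vM] := hM M (leqnn M).
have cM : \sum_(0 <= k < M) u N k @[N --> \oo] --> \sum_(0 <= k < M) v k.
  by apply: cvg_bigsum => k _; exact: uv.
have tail N : (M <= N.+1)%N -> `|\sum_(M <= k < N.+1) u N k| <= e / 3.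
  move=> MN; apply: le_trans (ler_norm_sum _ _ _) _.
  apply: (@le_trans _ _ (\sum_(M <= k < N.+1) g k)); first exact: ler_sum.
  rewrite -sub_series_geq//; apply: le_trans gM.
  apply: le_trans (ler_norm _); rewrite lerD2r.
  apply: nondecreasing_cvgn_le => //.
  by apply: nondecreasing_series => k _ _; exact: g0.
near=> N.
have MN : (M <= N.+1)%N by near: N; exists M => // m /= /leqW.
rewrite -(big_mkord xpredT) (@big_cat_nat _ _ _ M 0)//=.
rewrite [X in `|X|](_ : _ = (limn (series v) - series v M) +
  (\sum_(0 <= k < M) v k - \sum_(0 <= k < M) u N k) -
  \sum_(M <= k < N.+1) u N k); last by rewrite /series/=; ring.
apply: le_trans (ler_normB _ _) _.
have -> : e = e / 3 + e / 3 + e / 3 by field.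
apply: lerD; last exact: tail.
apply: le_trans (ler_normD _ _) _.
apply: lerD => //.
by near: N; have /cvgrPdist_le := cM; exact.
Unshelve. all: by end_near. Qed.

(** Twice Tannery: over l for each fixed k, then over k with the majorant
    g k * limn (series h). *)
Lemma Tannery_double (a : nat -> nat -> nat -> R) (b : nat -> nat -> R) g h :
  (forall k l, a N k l @[N --> \oo] --> b k l) ->
  (forall k, 0 <= g k) -> (forall l, 0 <= h l) ->
  (forall N k l, `|a N k l| <= g k * h l) ->
  cvgn (series g) -> cvgn (series h) ->
  \sum_(k < N.+1) \sum_(l < N.+1) a N k l @[N --> \oo] -->
    limn (series (fun k => limn (series (b k)))).
Proof.
move=> ab g0 h0 agh cg ch.
pose H := limn (series h).
have h_sum N : \sum_(l < N) h l <= H.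
  rewrite -(big_mkord xpredT); apply: nondecreasing_cvgn_le => //.
  by apply: nondecreasing_series => k _ _; exact: h0.
apply: (@Tannery (fun N k => \sum_(l < N.+1) a N k l) _ (fun k => g k * H)).
- move=> k; apply: (@Tannery (fun N l => a N k l) _ (fun l => g k * h l)) => //.
  exact: is_cvg_seriesZ.
- move=> N k; apply: le_trans (ler_norm_sum _ _ _) _.
  apply: (@le_trans _ _ (\sum_(l < N.+1) g k * h l)); first exact: ler_sum.
  by rewrite -mulr_sumr ler_wpM2l.
- under [X in cvgn (series X)]eq_fun do rewrite mulrC.
  exact: is_cvg_seriesZ.
Qed.
End Tannery.

(** * The Gamma function *)

(** Weighted AM-GM for 1 and t: divided by t^r, the right side is the (1 - r, r)
    mean of two exponentials whose exponents average to 0, and e^u >= 1 + u. *)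
Lemma powR_le_tangent (R : realType) (r t : R) : 0 <= r <= 1 -> 0 < t ->
  t `^ r <= 1 - r + r * t.
Proof.
move=> /andP[r0 r1] t0.
rewrite /powR gt_eqF// -{2}(lnK t0); set L := ln t.
have -> : 1 - r + r * expR L =
    expR (r * L) * ((1 - r) * expR (- (r * L)) + r * expR ((1 - r) * L)).
  rewrite mulrDr mulrCA -expRD subrr expR0 mulr1 mulrCA -expRD.
  by congr (_ + _ * expR _); ring.
rewrite ler_peMr ?expR_ge0//.
rewrite [leLHS](_ : 1 = (1 - r) * (1 + - (r * L)) + r * (1 + (1 - r) * L));
  last by ring.
by rewrite lerD// ler_wpM2l ?subr_ge0// expR_ge1Dx.
Qed.

(** Vanishing at infinity of the boundary term of Euler's integral, along the
    right ends of the exhausting intervals used below. *)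
Lemma cvg_powR_expRN (R : realType) (s : R) :
  expR (- n.+2%:R) * n.+2%:R `^ s @[n --> \oo] --> (0 : R).
Proof.
(* Compare x^s with x^k, k >= s, and e^x with x^(k + 1) / (k + 1)!. *)
pose k := (Num.truncn `|s|).+1.
have sk : s <= k%:R.
  by rewrite (le_trans (ler_norm s))// ltW// truncnS_gt.
apply: (@squeeze_cvgr _ _ _ _ (cst 0)
  (fun n : nat => (k.+1)`!%:R * (n.+1%:R)^-1 : R)).
- near=> n; rewrite mulr_ge0 ?expR_ge0 ?powR_ge0//=.
  set x : R := n.+2%:R.
  have x0 : 0 < x by [].
  have xk : x `^ s <= x ^+ k.
    by rewrite -powR_mulrn// ler_powR// /x ler1n.
  rewrite (@le_trans _ _ (expR (- x) * x ^+ k))//.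
    by rewrite ler_pM2l ?expR_gt0.
  rewrite expRN mulrC ler_pdivrMr ?expR_gt0// mulrAC ler_pdivlMr ?ltr0n//.
  have xkS : x ^+ k * n.+1%:R <= x ^+ k.+1.
    by rewrite exprSr ler_pM2l ?exprn_gt0// ler_nat.
  have f0 : 0 < k.+1`!%:R :> R by rewrite ltr0n fact_gt0.
  rewrite (le_trans xkS)// -ler_pdivrMl// mulrC.
  by rewrite (le_trans _ (expR_ge1Dxn k (ltW x0)))// lerDr.
- exact: cvg_cst.
- rewrite -[X in _ --> X](mulr0 (k.+1`!%:R : R)); apply: cvgMr.
  exact: cvg_harmonic.
Unshelve. all: by end_near. Qed.

Lemma cvg_powR_inv (R : realType) (s : R) : 0 < s ->
  (n.+2%:R^-1) `^ s @[n --> \oo] --> (0 : R).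
Proof.
move=> s0.
have /cvg_at_rightP := @powR_cvg0 R s s0; apply.
split=> [n|]; first by rewrite invr_gt0.
have := @cvg_harmonic R; rewrite -(cvg_shiftn 1) /=.
by apply: cvg_trans; apply: near_eq_cvg; near=> n; rewrite /= addn1.
Unshelve. all: by end_near. Qed.

Lemma derivable_LRcontinuous (R : realType) (F : R -> R) (a b : R) :
  a < b -> (forall t, a <= t <= b -> derivable F t 1) ->
  derivable_oo_LRcontinuous F a b.
Proof.
move=> ab dF; split.
- by move=> t; rewrite in_itv/= => /andP[/ltW at_ /ltW tb]; apply: dF; apply/andP.
- apply/cvg_at_right_filter; apply: differentiable_continuous.
  by apply/derivable1_diffP/dF; rewrite lexx ltW.
- apply/cvg_at_left_filter; apply: differentiable_continuous.
  by apply/derivable1_diffP/dF; rewrite lexx ltW.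
Qed.

Section Gamma_function.
Context {R : realType}.
Implicit Types s t p r : R.
Notation mu := (@lebesgue_measure R).

(** Euler's integral in the extended reals, where the functional equation can be
    proved before finiteness is known. *)
Let gam s : \bar R :=
  (\int[mu]_(t in `]0%R, +oo[) (t `^ (s - 1) * expR (- t))%:E)%E.

Let mgam s (D : set R) :
  measurable_fun D (EFin \o (fun t : R => t `^ (s - 1) * expR (- t))%R).
Proof.
apply/measurable_EFinP; apply: measurable_funTS; apply: measurable_funM.
  exact: measurable_powR.
by apply: measurableT_comp => //; exact: measurable_expR.
Qed.

Let gam0 s t : (0 <= (t `^ (s - 1) * expR (- t))%:E)%E.
Proof. by rewrite lee_fin mulr_ge0 ?powR_ge0 ?expR_ge0. Qed.

(** Compact intervals exhausting (0, +oo); the index shift by 2 keeps the left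
    end strictly below the right one. *)
Let box (n : nat) := `[n.+2%:R^-1, n.+2%:R : R]%classic.

Let mbox n : @measurable _ (measurableTypeR R) (box n).
Proof. exact: measurable_itv. Qed.

Let bigcup_box : \bigcup_n box n = `]0%R, +oo[%classic.
Proof.
apply/seteqP; split => [x [n _]|x] /=.
  rewrite /box /= !in_itv/= andbT => /andP[+ _].
  by apply: lt_le_trans; rewrite invr_gt0.
rewrite in_itv/= andbT => x0.
exists (Num.truncn (Num.max x x^-1)) => //; rewrite /box /= in_itv/=.
have [h1 h2] : (x <= Num.max x x^-1 /\ x^-1 <= Num.max x x^-1)%R.
  by rewrite !le_max !lexx orbT.
have h : (Num.max x x^-1 <= (Num.truncn (Num.max x x^-1)).+2%:R)%R.
  by rewrite (le_trans (ltW (truncnS_gt _)))// ler_nat.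
rewrite (le_trans h1 h) andbT -[leRHS]invrK lef_pV2 ?posrE ?invr_gt0//.
exact: le_trans h2 h.
Qed.

Let cvg_box s :
  (\int[mu]_(t in box n) (t `^ (s - 1) * expR (- t))%:E)%E @[n --> \oo]
    --> gam s.
Proof.
rewrite /gam -bigcup_box; apply: ge0_nondecreasing_set_cvg_integral => //.
- move=> n m nm; apply/subsetPset/subset_itv; rewrite bnd_simp/=.
    by rewrite lef_pV2 ?posrE// ler_nat.
  by rewrite ler_nat.
- by move=> n; exact: mgam.
Qed.

Let box_parts s n :
  (s%:E * \int[mu]_(t in box n) (t `^ (s - 1) * expR (- t))%:E =
  (expR (- n.+2%:R) * n.+2%:R `^ s - expR (- n.+2%:R^-1) * n.+2%:R^-1 `^ s)%:E
  + \int[mu]_(t in box n) (t `^ (s + 1 - 1) * expR (- t))%:E)%E.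
Proof.
rewrite addrK.
set a : R := n.+2%:R^-1; set b : R := n.+2%:R.
have a0 : 0 < a by rewrite invr_gt0.
have ab : a < b by rewrite (@lt_trans _ _ 1)// ?invf_lt1// ltr1n.
have ta (t : R) : t \in `[a, b] -> 0 < t.
  by rewrite in_itv/= => /andP[+ _]; exact: lt_le_trans.
have dpow r (t : R) : t \in `[a, b] ->
    is_derive t 1 (fun u : R => u `^ r) (r * t `^ (r - 1)).
  by move=> /ta t0; apply: is_derive1_powR.
have dexp (t : R) : is_derive t 1 (fun u : R => expR (- u)) (- expR (- t)).
  rewrite -mulrN1.
  by apply: (@is_derive1_comp _ expR (fun u : R => - u) t).
transitivity (\int[mu]_(t in `[a, b]) (expR (- t) * (s * t `^ (s - 1)))%:E)%E.
  have intf : mu.-integrable `[a, b]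
      (EFin \o (fun t : R => t `^ (s - 1) * expR (- t))).
    apply: continuous_compact_integrable; first exact: segment_compact.
    apply: derivable_within_continuous => t tab.
    by apply: derivableM; apply: ex_derive; first exact: dpow.
  rewrite -(integralZl (mbox n) intf).
  by apply: eq_integral => t _; rewrite /= -EFinM; congr EFin; ring.
transitivity ((expR (- b) * b `^ s - expR (- a) * a `^ s)%:E -
    \int[mu]_(t in `[a, b]) (- expR (- t) * t `^ s)%:E)%E.
  apply: (@integration_by_parts R (fun t => expR (- t)) (fun t => t `^ s)
    (fun t => - expR (- t)) (fun t => s * t `^ (s - 1)) a b ab).
  - apply: derivable_within_continuous => t tab.
    by apply: derivableN; apply: ex_derive.
  - by apply: derivable_LRcontinuous => // t _; apply: ex_derive.
  - by move=> t tab; rewrite derive1E; apply: derive_val.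
  - apply: derivable_within_continuous => t tab.
    by apply: derivableM => //; apply: ex_derive; exact: dpow.
  - apply: derivable_LRcontinuous => // t tab; apply: ex_derive.
    by apply: dpow; rewrite in_itv/=.
  - move=> t tab; rewrite derive1E; apply: derive_val; apply: dpow.
    by apply: subset_itv_oo_cc tab.
have -> : (\int[mu]_(t in `[a, b]) (- expR (- t) * t `^ s)%:E =
    - \int[mu]_(t in `[a, b]) (t `^ s * expR (- t))%:E)%E.
  rewrite -integral_ge0N => [|t _].
    by apply: eq_integral => t _; rewrite -EFinN mulrC mulrN.
  by rewrite lee_fin mulr_ge0 ?powR_ge0 ?expR_ge0.
by rewrite oppeK.
Qed.

Let cvg_boundary s : 0 <= s ->
  (expR (- n.+2%:R) * n.+2%:R `^ s - expR (- n.+2%:R^-1) * n.+2%:R^-1 `^ s)%:E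
    @[n --> \oo] --> (- (s == 0)%:R)%:E.
Proof.
move=> s0; apply: cvg_EFin; first exact: nearW.
rewrite -[X in _ --> X]add0r; apply: cvgB; first exact: cvg_powR_expRN.
have cinv : (n.+2%:R^-1 : R) @[n --> \oo] --> (0 : R).
  have := @cvg_harmonic R; rewrite -(cvg_shiftn 1) /=.
  by apply: cvg_trans; apply: near_eq_cvg; near=> n; rewrite /= addn1.
rewrite -[X in _ --> X]mul1r; apply: cvgM.
  rewrite -[X in _ --> X](@expR0 R) -[X in _ --> expR X]oppr0.
  apply: (@continuous_cvg _ _ _ _ _ _ expR); first exact: continuous_expR.
  exact: cvgN cinv.
have [->|s_neq0] := eqVneq s 0.
  by under eq_fun do rewrite powRr0; exact: cvg_cst.
by apply: cvg_powR_inv; rewrite lt0r s_neq0.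
Unshelve. all: by end_near. Qed.

(** The case s = 0 is kept because its boundary term, e^(-t) between 0 and
    infinity, is what computes gam 1. *)
Let gamS_gen s : 0 <= s ->
  (s%:E * gam s)%E = ((- (s == 0)%:R)%:E + gam (s + 1))%E.
Proof.
move=> s0.
have h1 : (s%:E * \int[mu]_(t in box n) (t `^ (s - 1) * expR (- t))%:E)%E
    @[n --> \oo] --> (s%:E * gam s)%E.
  by apply: cvgeZl.
have h2 := @cvgeD _ _ _ _ _ _ _ _ _ (cvg_boundary s0) (@cvg_box (s + 1)).
rewrite (funext (@box_parts s)) in h1.
have <- := cvg_lim (@ereal_hausdorff R) h1.
by apply/cvg_lim => //; apply: h2; rewrite fin_num_adde_defr.
Qed.

Let gam1 : gam 1 = 1%E.
Proof.
have := @gamS_gen 0 (lexx _); rewrite eqxx mul0e add0r.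
case: (gam 1) => [r||] //.
by rewrite -EFinD => -[] /eqP; rewrite eq_sym addrC subr_eq0 => /eqP ->.
Qed.

Let gamS s : 0 < s -> (s%:E * gam s)%E = gam (s + 1).
Proof. by move=> s0; rewrite gamS_gen ?ltW// gt_eqF// oppr0 add0e. Qed.

Let gam_ge0 s : (0 <= gam s)%E.
Proof. by apply: integral_ge0 => t _; exact: gam0. Qed.

Let gamZ (c : R) s : 0 <= c -> (c%:E * gam s =
  \int[mu]_(t in `]0%R, +oo[) (c * (t `^ (s - 1) * expR (- t)))%:E)%E.
Proof.
by move=> c0; rewrite /gam -ge0_integralZl//; exact: mgam.
Qed.

(** On [1, 2] the integrand is at most (1 + t) e^(-t), because
    t^(r - 1) <= 1 + t; the functional equation carries finiteness to every
    other interval. *)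
Let gam_lty s : 0 < s -> (gam s < +oo)%E.
Proof.
have gam12 r : 1 <= r <= 2 -> (gam r < +oo)%E.
  move=> /andP[r1 r2].
  have : (gam r <= gam 1 + gam 2)%E.
    rewrite /gam -ge0_integralD//; [| exact: mgam.. ].
    apply: ge0_le_integral => //; [exact: mgam| |].
      by apply: emeasurable_funD; exact: mgam.
    move=> t; rewrite /= in_itv/= andbT => t0.
    rewrite -EFinD lee_fin -mulrDl ler_wpM2r ?expR_ge0//.
    have r01 : 0 <= r - 1 <= 1 by apply/andP; split; lra.
    apply: le_trans (powR_le_tangent r01 t0) _.
    rewrite subrr powRr0 (_ : 2 - 1 = 1); last by ring.
    by rewrite powRr1 ?ltW//; nra.
  move=> /le_lt_trans; apply.
  have -> : 2 = 1 + 1 :> R by [].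
  by rewrite -gamS// mul1e gam1 ltry.
have lty1 r : 0 < r -> (gam (r + 1) < +oo)%E -> (gam r < +oo)%E.
  move=> r0; rewrite -gamS//; case: (gam r) => [x _||//].
    exact: ltry.
  by rewrite gt0_muley ?lte_fin// ltxx.
have ltyS r : 0 < r -> (gam r < +oo)%E -> (gam (r + 1) < +oo)%E.
  by move=> r0 h; rewrite -gamS// lte_mul_pinfty// lee_fin ltW.
have all n r : 0 < r <= n.+1%:R -> (gam r < +oo)%E.
  elim: n r => [|n IH] r /andP[r0 rn].
    by apply: lty1 => //; apply: gam12; apply/andP; split; lra.
  have [r1|r1] := lerP r 1; first by apply: IH; rewrite r0 (le_trans r1)// ler1n.
  rewrite -(subrK 1 r); apply: ltyS; first by rewrite subr_gt0.
  by apply: IH; rewrite subr_gt0 r1/= lerBlDr natr1.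
move=> s0; apply: (all (Num.truncn s)); rewrite s0/=.
by rewrite ltW// truncnS_gt.
Qed.

Let GammaE s : 0 < s -> (Gamma s)%:E = gam s.
Proof.
move=> s0; rewrite /Gamma /Rintegral -/(gam s) fineK// ge0_fin_numE//.
exact: gam_lty.
Qed.

Lemma GammaS s : 0 < s -> Gamma (s + 1) = s * Gamma s.
Proof.
move=> s0; have s10 : 0 < s + 1 by rewrite addr_gt0.
by apply: EFin_inj; rewrite EFinM (GammaE s10) (GammaE s0) gamS.
Qed.

Lemma Gamma1 : Gamma (1 : R) = 1.
Proof. by apply: EFin_inj; rewrite GammaE. Qed.

Lemma Gamma_nat n : Gamma (n.+1%:R : R) = n`!%:R.
Proof.
by elim: n => [|n IH]; rewrite ?Gamma1// -natr1 GammaS// IH factS natrM.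
Qed.

(** Integrate t^(p + r - 1) = p^r t^(p - 1) (t / p)^r after bounding (t / p)^r by
    1 - r + r (t / p): the two resulting integrals recombine, by the functional
    equation, to p^r Gamma p.  This is the part of
    log-convexity that Euler's limit uses. *)
Lemma Gamma_addr_le p r : 0 < p -> 0 <= r <= 1 ->
  Gamma (p + r) <= p `^ r * Gamma p.
Proof.
move=> p0 /andP[r0 r1]; have pr0 : 0 < p + r by rewrite ltr_pwDl.
rewrite -lee_fin EFinM (GammaE pr0) (GammaE p0).
have -> : ((p `^ r)%:E * gam p =
  (p `^ r * (1 - r))%:E * gam p + (p `^ r * (r / p))%:E * gam (p + 1))%E.
  rewrite -gamS// -GammaE// -!EFinM -EFinD; congr EFin; field.
  exact: lt0r_neq0.
have pp0 := powR_ge0 p r.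
have c1 : 0 <= p `^ r * (1 - r) by rewrite mulr_ge0// subr_ge0.
have c2 : 0 <= p `^ r * (r / p) by rewrite mulr_ge0// divr_ge0// ltW.
have mZ (c : R) s : measurable_fun (`]0, +oo[%classic : set R)
    (EFin \o (fun t : R => c * (t `^ (s - 1) * expR (- t)))).
  apply/measurable_EFinP; apply: measurable_funM; first exact: measurable_cst.
  by apply/measurable_EFinP; exact: mgam.
have Z0 (c : R) s t : 0 <= c -> (0 <= (c * (t `^ (s - 1) * expR (- t)))%:E)%E.
  by move=> c0; rewrite lee_fin mulr_ge0// -lee_fin; exact: gam0.
rewrite !gamZ// -ge0_integralD//; [|by move=> *; exact: Z0|exact: mZ
  |by move=> *; exact: Z0|exact: mZ].
apply: ge0_le_integral => //; [exact: mgam|by apply: emeasurable_funD; exact: mZ|].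
move=> t; rewrite /= in_itv/= andbT => t0.
have -> : t `^ (p + r - 1) = p `^ r * t `^ (p - 1) * (t / p) `^ r.
  rewrite mulrAC -powRM ?divr_ge0 ?(ltW p0) ?(ltW t0)//.
  rewrite mulrCA divff ?(lt0r_neq0 p0)// mulr1 -powRD.
    by congr powR; ring.
  by rewrite (gt_eqF t0) implybT.
have -> : t `^ (p + 1 - 1) = t * t `^ (p - 1) .
  by rewrite mulr_powRB1 ?(ltW t0) ?addrK.
rewrite -EFinD lee_fin.
have -> : p `^ r * (1 - r) * (t `^ (p - 1) * expR (- t)) +
    p `^ r * (r / p) * (t * t `^ (p - 1) * expR (- t)) =
    p `^ r * t `^ (p - 1) * (1 - r + r * (t / p)) * expR (- t).
  by field; exact: lt0r_neq0.
rewrite ler_wpM2r ?expR_ge0// ler_wpM2l ?mulr_ge0 ?powR_ge0//.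
by apply: powR_le_tangent; rewrite ?divr_gt0// r0.
Qed.

End Gamma_function.

(** * Euler's product for the Gamma function *)

Section Euler_product.
Context {R : realType}.
Implicit Types s : R.

(** Euler's product with N = n + 1 factors, normalized by (N - 1)! N^s. *)
Definition euler_ratio s n : R :=
  (\prod_(m < n.+1) (s + m%:R)) / (n`!%:R * n.+1%:R `^ s).

Lemma Gamma_addn s n : 0 < s ->
  Gamma (s + n%:R) = (\prod_(m < n) (s + m%:R)) * Gamma s.
Proof.
move=> s0; elim: n => [|n IH]; first by rewrite addr0 big_ord0 mul1r.
have sn0 : 0 < s + n%:R by rewrite ltr_wpDr.
have -> : s + n.+1%:R = s + n%:R + 1 by rewrite -natr1 addrA.
rewrite (GammaS sn0) IH big_ord_recr /=.
by rewrite mulrCA mulrA.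
Qed.

Let gquot s n : R := Gamma (s + n.+1%:R) / (n`!%:R * n.+1%:R `^ s).

Let cvg_shift_ratio s : (n.+1%:R + s) / n.+1%:R @[n --> \oo] --> (1 : R).
Proof.
rewrite -[X in _ --> X]addr0 -[X in _ --> _ + X](mulr0 s).
have -> : (fun n => (n.+1%:R + s) / n.+1%:R : R) = (fun n => 1 + s * harmonic n).
  by apply/funext => n; rewrite mulrDl divff.
by apply: cvgD; [exact: cvg_cst|apply: cvgMr; exact: cvg_harmonic].
Qed.

(** For 0 < s <= 1 and N = n + 1, Gamma_addr_le gives Gamma (N + s) <= N^s Gamma N
    and Gamma (N + 1) <= (N + s)^(1 - s) Gamma (N + s); the latter bounds the
    quotient below by N / (N + s). *)
Let cvg_gquot01 s : 0 < s <= 1 -> gquot s n @[n --> \oo] --> (1 : R).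
Proof.
move=> /andP[s0 s1].
have N0 n : 0 < n.+1%:R + s :> R by rewrite ltr_pwDr.
have cV : n.+1%:R / (n.+1%:R + s) @[n --> \oo] --> (1 : R).
  rewrite -[X in _ --> X]invr1.
  under eq_fun do rewrite -invf_div.
  by apply: cvgV => //; exact: cvg_shift_ratio.
apply: (squeeze_cvgr _ cV (cvg_cst (1 : R))); near=> n.
have d0 : 0 < n`!%:R * n.+1%:R `^ s :> R.
  by rewrite mulr_gt0 ?powR_gt0// ltr0n fact_gt0.
have up : Gamma (s + n.+1%:R) <= n.+1%:R `^ s * n`!%:R.
  by rewrite addrC -Gamma_nat Gamma_addr_le// s1 ltW.
have low : n.+1`!%:R <= (n.+1%:R + s) `^ (1 - s) * Gamma (s + n.+1%:R).
  rewrite -Gamma_nat -natr1.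
  rewrite (_ : n.+1%:R + 1 = (n.+1%:R + s) + (1 - s)); last by ring.
  by rewrite [s + _]addrC Gamma_addr_le// subr_ge0 s1/= lerBlDr lerDl ltW.
have b0 := N0 n; set b := _ + s in b0 low *.
have bs0 : 0 < b `^ s by rewrite powR_gt0.
have ab : n.+1%:R `^ s <= b `^ s.
  by apply: ge0_ler_powR; rewrite ?nnegrE ?(ltW b0) ?(ltW s0)// lerDl ltW.
have bE : b `^ (1 - s) = b / b `^ s.
  by rewrite powRB ?powRr1 ?(ltW b0)// (gt_eqF b0) implybT.
rewrite /gquot; apply/andP; split; last first.
  by rewrite ler_pdivrMr// mul1r mulrC.
rewrite ler_pdivlMr//.
apply: (@le_trans _ _ (n.+1%:R / b * (n`!%:R * b `^ s))).
  by rewrite ler_wpM2l ?divr_ge0 ?(ltW b0)// ler_wpM2l.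
move: low; rewrite bE factS natrM.
set G := Gamma _; rewrite mulrAC (ler_pdivlMr _ _ bs0) => low.
rewrite [leLHS](_ : _ = n.+1%:R * n`!%:R * b `^ s / b); last by ring.
by rewrite (ler_pdivrMr _ _ b0) [G * b]mulrC.
Unshelve. all: by end_near. Qed.

Let cvg_gquotS s : 0 < s -> gquot s n @[n --> \oo] --> (1 : R) ->
  gquot (s + 1) n @[n --> \oo] --> (1 : R).
Proof.
move=> s0 cs.
have -> : gquot (s + 1) = (fun n => gquot s n * ((n.+1%:R + s) / n.+1%:R)).
  apply/funext => n; rewrite /gquot.
  rewrite powRD; last by rewrite pnatr_eq0 implybT.
  rewrite addrAC GammaS ?ltr_wpDr// powRr1//.
  have ? : n.+1%:R `^ s != 0 :> R by rewrite gt_eqF// powR_gt0.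
  have ? : n`!%:R != 0 :> R by rewrite pnatr_eq0 -lt0n fact_gt0.
  by field; apply/andP; split => //; apply/andP; split.
by rewrite -[X in _ --> X]mulr1; apply: cvgM.
Qed.

Let cvg_gquot s : 0 < s -> gquot s n @[n --> \oo] --> (1 : R).
Proof.
have all k r : 0 < r <= k.+1%:R -> gquot r n @[n --> \oo] --> (1 : R).
  elim: k r => [|k IH] r /andP[r0 rk]; first by apply: cvg_gquot01; rewrite r0.
  have [r1|r1] := lerP r 1; first by apply: IH; rewrite r0 (le_trans r1)// ler1n.
  rewrite -(subrK 1 r); apply: cvg_gquotS; first by rewrite subr_gt0.
  by apply: IH; rewrite subr_gt0 r1/= lerBlDr natr1.
move=> s0; apply: (all (Num.truncn s)); rewrite s0/=.
by rewrite ltW// truncnS_gt.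
Qed.

Let gquotE s n : 0 < s -> gquot s n = euler_ratio s n * Gamma s.
Proof. by move=> s0; rewrite /gquot Gamma_addn// mulrAC. Qed.

(** Otherwise all the quotients above would be 0, yet they tend to 1. *)
Lemma Gamma_neq0 s : 0 < s -> Gamma s != 0.
Proof.
move=> s0; apply/eqP => G0; have := cvg_gquot s0.
under eq_fun do rewrite gquotE// G0 mulr0.
move=> /(cvg_lim (@Rhausdorff R)); rewrite lim_cst// => /eqP.
by rewrite eq_sym oner_eq0.
Qed.

Lemma cvg_euler_ratio s : 0 < s ->
  euler_ratio s n @[n --> \oo] --> (Gamma s)^-1.
Proof.
move=> s0; have G0 := Gamma_neq0 s0.
have -> : euler_ratio s = (fun n => gquot s n * (Gamma s)^-1).
  by apply/funext => n; rewrite gquotE// mulfK.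
by rewrite -[X in _ --> X]mul1r; apply: cvgMl; exact: cvg_gquot.
Qed.

Lemma euler_ratio_ge0 s n : 0 < s -> 0 <= euler_ratio s n.
Proof.
move=> s0; rewrite divr_ge0 ?mulr_ge0 ?powR_ge0//.
by apply: prodr_ge0 => i _; rewrite addr_ge0// ltW.
Qed.

(** Uniform in n and only exponential in s: compare the product of the 1 + s / m
    with exp (s * sum 1 / m) and the harmonic sum with 1 + ln n.  In the
    induction this reads 1 + s / x <= e^(s / x) <= (1 - 1 / x)^(-s). *)
Lemma euler_ratio_le s n : 0 < s -> euler_ratio s n <= s * expR s.
Proof.
move=> s0.
(* The power has base k + 1 although there are k + 2 factors: with base k + 2
   the induction step would fail for s < 1. *)
have prodS k : \prod_(m < k.+2) (s + m%:R) <=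
    s * expR s * (k.+1`!%:R * k.+1%:R `^ s).
  elim: k => [|k IH].
    rewrite big_ord_recr/= big_ord1 addr0 powR1 !mulr1 ler_wpM2l ?(ltW s0)//.
    by rewrite addrC expR_ge1Dx.
  rewrite big_ord_recr/=.
  apply: (le_trans (ler_wpM2r _ IH)); first by rewrite addr_ge0// ltW.
  rewrite -!mulrA !ler_wpM2l ?expR_ge0 ?(ltW s0)//.
  rewrite [k.+2`!]factS natrM -[leRHS]mulrA [leRHS]mulrCA ler_wpM2l//.
  set x : R := k.+2%:R.
  have x0 : 0 < x by [].
  have kx : k.+1%:R = x * (1 - x^-1).
    by rewrite mulrBr mulr1 divff ?gt_eqF// /x -[k.+2%:R]natr1 addrK.
  have xV1 : 0 <= 1 - x^-1 by rewrite subr_ge0 invf_le1// ler1n.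
  rewrite kx powRM ?(ltW x0)// [leLHS](_ : _ =
    x * x `^ s * ((1 + s / x) * (1 - x^-1) `^ s)); last first.
    by field; rewrite gt_eqF.
  rewrite -[leRHS]mulr1 ler_wpM2l ?mulr_ge0 ?powR_ge0 ?(ltW x0)//.
  apply: (@le_trans _ _ (expR (s / x) * expR (- x^-1 * s))); last first.
    by rewrite -expRD mulNr mulrC subrr expR0.
  apply: ler_pM; rewrite ?powR_ge0//.
  - by rewrite addr_ge0// divr_ge0// ltW.
  - exact: expR_ge1Dx.
  - rewrite expRM ge0_ler_powR ?nnegrE ?expR_ge0 ?(ltW s0)//.
    exact: expR_ge1Dx.
rewrite /euler_ratio ler_pdivrMr; last first.
  by rewrite mulr_gt0 ?powR_gt0// ltr0n fact_gt0.
case: n => [|n].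
  rewrite big_ord1 addr0 powR1 !mulr1 ler_peMr ?(ltW s0)//.
  by rewrite (le_trans _ (expR_ge1Dx s))// lerDl ltW.
apply: le_trans (prodS n) _.
rewrite ler_wpM2l ?mulr_ge0 ?expR_ge0 ?(ltW s0)// ler_wpM2l//.
by apply: ge0_ler_powR; rewrite ?nnegrE ?(ltW s0)// ler_nat.
Qed.

End Euler_product.

(** * Coefficients of Wright's function *)

Section Wright_coefficients.
Context {R : realType}.
Implicit Types (a b x : R).

(** The m-th term of wrightJ. *)
Definition wright_coef a b x (m : nat) : R :=
  (- x) ^+ m / (m`!%:R * Gamma (a + b * m%:R)).

Definition ffact_ratio (n m : nat) : R := (n ^_ m)%:R / n.+1%:R ^+ m.

(** The finite-N version of wright_coef, with N = n + 1; it vanishes for m >= N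
    because the falling factorial does. *)
Definition wright_approx n a b x (m : nat) : R :=
  (- x) ^+ m / m`!%:R * ffact_ratio n m * euler_ratio (a + b * m%:R) n.

(** Terms of the exponential series, dominating wright_approx: since
    s <= e^s, the bound s e^s on euler_ratio is at most e^(2 s), which is
    geometric in m for s = a + b m. *)
Definition wright_dom a b x (m : nat) : R :=
  expR (2 * a) * exp_coeff (x * expR (2 * b)) m.

Let ffact_ratioE n m :
  ffact_ratio n m = \prod_(i < m) ((n - i)%:R / n.+1%:R).
Proof.
rewrite prodf_div -natr_prod -ffact_prod; congr (_ / _).
by rewrite prodr_const card_ord.
Qed.

Lemma ffact_ratio_ge0 n m : 0 <= ffact_ratio n m.
Proof. by rewrite divr_ge0// exprn_ge0. Qed.

Lemma ffact_ratio_le1 n m : ffact_ratio n m <= 1.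
Proof.
rewrite ffact_ratioE; apply: prodr_ile1 => i _.
rewrite divr_ge0//= ler_pdivrMr// mul1r ler_nat.
by rewrite (leq_trans (leq_subr _ _)).
Qed.

Lemma cvg_ffact_ratio m : ffact_ratio n m @[n --> \oo] --> (1 : R).
Proof.
under eq_fun do rewrite ffact_ratioE.
have := @cvg_bigprod R 'I_m (index_enum _) xpredT
  (fun i n => (n - i)%:R / n.+1%:R) (fun=> 1).
rewrite big1 //; apply => i _.
have h : 1 - i.+1%:R * harmonic n @[n --> \oo] --> (1 : R).
  rewrite -[X in _ --> X]subr0; apply: cvgB; first exact: cvg_cst.
  rewrite -[X in _ --> X](mulr0 i.+1%:R); apply: cvgMr; exact: cvg_harmonic.
apply: cvg_trans h; apply: near_eq_cvg; near=> n.
have ni : (i <= n)%N by near: n; exact: nbhs_infty_ge.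
rewrite natrB// /harmonic/= -(natr1 i) -(natr1 n).
by field; rewrite natr1.
Unshelve. all: by end_near. Qed.

Lemma cvg_wright_approx a b x m : 0 < a -> 0 <= b ->
  wright_approx n a b x m @[n --> \oo] --> wright_coef a b x m.
Proof.
move=> a0 b0; have ab0 : 0 < a + b * m%:R by rewrite ltr_pwDl// mulr_ge0.
rewrite /wright_coef invfM mulrA; apply: cvgM; last exact: cvg_euler_ratio.
by rewrite -[X in _ --> X]mulr1; apply: cvgMr; exact: cvg_ffact_ratio.
Qed.

Lemma wright_approx_le n a b x m : 0 < a -> 0 <= b ->
  `|wright_approx n a b x m| <= wright_dom a b `|x| m.
Proof.
move=> a0 b0; have ab0 : 0 < a + b * m%:R by rewrite ltr_pwDl// mulr_ge0.
rewrite /wright_approx 2!normrM.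
rewrite normrM normfV normrX normrN (ger0_norm (ffact_ratio_ge0 _ _)).
rewrite (ger0_norm (euler_ratio_ge0 _ ab0)) normr_nat.
have xm0 : 0 <= `|x| ^+ m / m`!%:R by rewrite divr_ge0// exprn_ge0.
apply: (@le_trans _ _ (`|x| ^+ m / m`!%:R * expR (2 * (a + b * m%:R)))).
  rewrite -mulrA ler_wpM2l//.
  apply: (@le_trans _ _ (euler_ratio (a + b * m%:R) n)).
    by rewrite ler_piMl ?euler_ratio_ge0// ffact_ratio_le1.
  apply: le_trans (euler_ratio_le _ ab0) _.
  set s := a + _; rewrite (_ : 2 * s = s + s); last by ring.
  rewrite expRD ler_wpM2r ?expR_ge0//.
  by rewrite (le_trans _ (expR_ge1Dx _))// lerDr.
rewrite /wright_dom /exp_coeff/= exprMn -expRM_natr.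
rewrite (_ : 2 * (a + b * m%:R) = 2 * a + 2 * b * m%:R); last by ring.
by rewrite expRD le_eqVlt; apply/orP; left; apply/eqP; ring.
Qed.

Lemma wright_dom_ge0 a b x m : 0 <= x -> 0 <= wright_dom a b x m.
Proof.
by move=> x0; rewrite mulr_ge0 ?expR_ge0// exp_coeff_ge0 ?mulr_ge0 ?expR_ge0.
Qed.

Lemma cvg_wright_dom a b x : cvgn (series (wright_dom a b x)).
Proof. by apply: is_cvg_seriesZ; exact: is_cvg_series_exp_coeff. Qed.

(** A limit of wright_approx_le: the upper bound on 1 / Gamma comes from the
    Euler products. *)
Lemma wright_coef_le a b x m : 0 < a -> 0 <= b ->
  `|wright_coef a b x m| <= wright_dom a b `|x| m.
Proof.
move=> a0 b0; have /cvg_norm h := @cvg_wright_approx a b x m a0 b0.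
apply: (cvgr_to_le h).
by near=> n; exact: wright_approx_le.
Unshelve. all: by end_near. Qed.

Lemma cvg_wrightJ a b x : 0 < a -> 0 <= b ->
  \sum_(m < n.+1) wright_coef a b x m @[n --> \oo] --> wrightJ a b x.
Proof.
move=> a0 b0.
have c : series (wright_coef a b x) n @[n --> \oo] --> wrightJ a b x.
  apply: (@dominated_series_cvg _ _ (wright_dom a b `|x|)).
    by move=> m; exact: wright_coef_le.
  exact: cvg_wright_dom.
move: c; rewrite -(cvg_shiftS (series _)); apply: cvg_trans.
by apply: near_eq_cvg; near=> n; rewrite /series/= big_mkord.
Unshelve. all: by end_near. Qed.

Lemma sum_wright_coef_le a b x y n : 0 < a -> 0 <= b -> `|x| <= y ->
  `|\sum_(m < n) wright_coef a b x m| <= limn (series (wright_dom a b y)).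
Proof.
move=> a0 b0 xy; have y0 : 0 <= y := le_trans (normr_ge0 x) xy.
apply: le_trans (ler_norm_sum _ _ _) _.
apply: (@le_trans _ _ (\sum_(m < n) wright_dom a b y m)).
  apply: ler_sum => m _; apply: le_trans (wright_coef_le _ _ a0 b0) _.
  rewrite ler_wpM2l ?expR_ge0// /exp_coeff/= ler_wpM2r ?invr_ge0//.
  by rewrite lerXn2r ?nnegrE ?mulr_ge0 ?expR_ge0// ler_wpM2r ?expR_ge0.
rewrite -(big_mkord xpredT); apply: nondecreasing_cvgn_le => //.
  by apply: nondecreasing_series => m _ _; exact: wright_dom_ge0.
exact: cvg_wright_dom.
Qed.

End Wright_coefficients.

(** * Integrals over the unit interval *)

Section integral01.
Context {R : realType}.
Implicit Types (f g : R -> R) (e : R).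
Notation mu := (@lebesgue_measure R).

(** Integrability and value are carried together so that both pass through
    linear combinations at once. *)
Definition int01 f (v : R) : Prop :=
  mu.-integrable `]0%R, 1%R[ (EFin \o f) /\
  (\int[mu]_(t in `]0%R, 1%R[) (f t)%:E = v%:E)%E.

Lemma int01_ext f g v : (forall t, 0 < t < 1 -> f t = g t) ->
  int01 f v -> int01 g v.
Proof.
move=> fg [If vf]; split.
  apply: eq_integrable If => // t; rewrite inE/= in_itv/= => t01.
  by rewrite fg.
rewrite -vf; apply: eq_integral => t; rewrite inE/= in_itv/= => t01.
by rewrite fg.
Qed.

Lemma int01D f g v w : int01 f v -> int01 g w ->
  int01 (fun t => f t + g t) (v + w).
Proof.
move=> [If vf] [Ig wg]; split; first exact: integrableD If Ig.
by under eq_integral do rewrite EFinD; rewrite integralD// vf wg.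
Qed.

Lemma int01Z c f v : int01 f v -> int01 (fun t => c * f t) (c * v).
Proof.
move=> [If vf]; split; first exact: integrableZl If.
by under eq_integral do rewrite EFinM; rewrite integralZl// vf.
Qed.

Lemma int01_sum (I : Type) (r : seq I) (f : I -> R -> R) (v : I -> R) :
  (forall i, int01 (f i) (v i)) ->
  int01 (fun t => \sum_(i <- r) f i t) (\sum_(i <- r) v i).
Proof.
move=> fv; elim: r => [|i r IH].
  rewrite big_nil; split.
    by apply: eq_integrable (integrable0 _ _) => // t _; rewrite /= big_nil.
  by under eq_integral do rewrite big_nil; rewrite integral0.
rewrite big_cons; apply: (@int01_ext (fun t => f i t + \sum_(j <- r) f j t)).
  by move=> t _; rewrite big_cons.
exact: int01D.
Qed.

Let box (n : nat) := `[n.+2%:R^-1, 1%R : R]%classic.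

Let bigcup_box : \bigcup_n box n = `]0%R, 1%R]%classic.
Proof.
apply/seteqP; split => [x [n _]|x] /=.
  rewrite /box /= !in_itv/= => /andP[+ ->]; rewrite andbT.
  by apply: lt_le_trans; rewrite invr_gt0.
rewrite in_itv/= => /andP[x0 x1].
exists (Num.truncn x^-1) => //; rewrite /box /= in_itv/= x1 andbT.
rewrite -[leRHS]invrK lef_pV2 ?posrE ?invr_gt0//.
by rewrite (le_trans (ltW (truncnS_gt _)))// ler_nat.
Qed.

Let mpow e (D : set R) : measurable_fun D (EFin \o (fun t : R => t `^ e)).
Proof.
by apply/measurable_EFinP; apply: measurable_funTS; exact: measurable_powR.
Qed.

(** For e < 0 the integrand is unbounded at 0, so the fundamental theorem is
    applied on [1 / (n + 2), 1] and followed by monotone convergence. *)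
Lemma int01_powR e : -1 < e -> int01 (fun t => t `^ e) (e + 1)^-1.
Proof.
move=> e1; have e0 : 0 < e + 1 by rewrite -ltrBlDr sub0r.
have FTC n : (\int[mu]_(t in box n) (t `^ e)%:E =
    ((e + 1)^-1 * (1 - n.+2%:R^-1 `^ (e + 1)))%:E)%E.
  have a0 : 0 < n.+2%:R^-1 :> R by rewrite invr_gt0.
  have a1 : n.+2%:R^-1 < 1 :> R by rewrite invf_lt1// ltr1n.
  have ta (t : R) : t \in `[n.+2%:R^-1, 1] -> 0 < t.
    by rewrite in_itv/= => /andP[+ _]; exact: lt_le_trans.
  have dF (t : R) : 0 < t ->
    is_derive t 1 (fun u : R => (e + 1)^-1 * u `^ (e + 1)) (t `^ e).
    move=> t0; have -> : t `^ e = (e + 1)^-1 * ((e + 1) * t `^ (e + 1 - 1)).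
      by rewrite mulrA mulVf ?gt_eqF// mul1r addrK.
    by apply: is_deriveZ; exact: is_derive1_powR.
  rewrite (@continuous_FTC2 _ _ (fun u : R => (e + 1)^-1 * u `^ (e + 1)))//.
  - by rewrite -EFinB powR1 mulrBr.
  - apply: derivable_within_continuous => t /ta t0.
    by apply: derivable_powR; rewrite in_itv/= t0.
  - apply: derivable_LRcontinuous => // t tab; apply: ex_derive.
    by apply: dF; apply: ta; rewrite in_itv.
  - move=> t tab; rewrite derive1E; apply: derive_val; apply: dF.
    by apply: ta; exact: subset_itv_oo_cc tab.
have cvg1 : (\int[mu]_(t in box n) (t `^ e)%:E)%E @[n --> \oo] -->
    (\int[mu]_(t in `]0%R, 1%R]) (t `^ e)%:E)%E.
  rewrite -bigcup_box; apply: ge0_nondecreasing_set_cvg_integral => //.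
  - move=> n m nm; apply/subsetPset/subset_itv; rewrite bnd_simp//=.
    by rewrite lef_pV2 ?posrE// ler_nat.
  - by move=> n; exact: measurable_itv.
  - by move=> n; exact: mpow.
  - by move=> n t _; rewrite lee_fin powR_ge0.
have cvg2 : (((e + 1)^-1 * (1 - n.+2%:R^-1 `^ (e + 1)))%:E)%E @[n --> \oo] -->
    ((e + 1)^-1)%:E.
  apply: cvg_EFin; first exact: nearW.
  rewrite -[X in _ --> X]mulr1; apply: cvgMr.
  rewrite -[X in _ --> X]subr0; apply: cvgB; first exact: cvg_cst.
  exact: cvg_powR_inv.
have int_e : (\int[mu]_(t in `]0%R, 1%R[) (t `^ e)%:E = ((e + 1)^-1)%:E)%E.
  rewrite -(@integral_itv_bndoo R 0 1 _ false false); last exact: mpow.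
  rewrite (funext FTC) in cvg1.
  rewrite -(cvg_lim (@ereal_hausdorff R) cvg1).
  exact/cvg_lim.
split => //; apply/integrableP; split; first exact: mpow.
under eq_integral do rewrite /= ger0_norm ?powR_ge0//.
by rewrite int_e ltry.
Qed.

End integral01.

(** * Correlation functions of the biorthogonal Jacobi ensemble *)

Section jacobi_correlation.
Context {R : realType}.
Variables (alpha theta : R) (N : nat).
Hypotheses (theta_gt0 : 0 < theta) (alpha_gtN1 : -1 < alpha).
Notation mu := (@lebesgue_measure R).

(** With this shift, k + jac_exp l is one more than the exponent of
    t^k t^(theta l) t^alpha, hence the inverse of its integral over (0, 1). *)
Definition jac_exp (l : nat) : R := alpha + 1 + theta * l%:R.

(** Inverse of the moment matrix. *)
Definition jac_coef (k l : 'I_N) : R :=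
  cauchy_inv (fun k : 'I_N => k%:R) (fun l : 'I_N => jac_exp l) k l.

(** The Christoffel-Darboux kernel of the biorthogonal system, without the factor
    x^alpha. *)
Definition jac_kernel (x y : R) : R :=
  \sum_(k < N) \sum_(l < N) jac_coef k l * x ^+ k * (y `^ theta) ^+ l.

Let exp_gt0 k l : 0 < k%:R + jac_exp l.
Proof.
rewrite ltr_wpDl// /jac_exp ltr_pwDl//; first by rewrite -ltrBlDr sub0r.
by rewrite mulr_ge0// ltW.
Qed.

Let sum_coef (k i : 'I_N) :
  \sum_l jac_coef k l / (i%:R + jac_exp l) = (k == i)%:R.
Proof.
apply: sum_cauchy_inv.
- move=> l m /addrI /mulfI h; apply/val_inj/eqP; rewrite /= -(eqr_nat R).
  by rewrite h// gt_eqF.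
- by move=> l m /eqP; rewrite eqr_nat => /eqP/val_inj.
- by move=> k' l; rewrite gt_eqF.
Qed.

Let Cmx : 'M[R]_N := \matrix_(k, l) jac_coef k l.

Let detC_neq0 : \det Cmx != 0.
Proof.
have : Cmx *m (\matrix_(l < N, i < N) (i%:R + jac_exp l)^-1) = 1%:M.
  apply/matrixP => k i; rewrite !mxE -sum_coef; apply: eq_bigr => l _.
  by rewrite !mxE.
move=> /(congr1 determinant); rewrite det_mulmx det1 => h.
by apply: contra_eq_neq h => ->; rewrite mul0r eq_sym oner_neq0.
Qed.

Lemma int01_monomial (k l : nat) :
  int01 (fun t => t ^+ k * (t `^ theta) ^+ l * t `^ alpha)
    (k%:R + jac_exp l)^-1.
Proof.
have e1 : -1 < alpha + k%:R + theta * l%:R.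
  by have := exp_gt0 k l; rewrite /jac_exp; lra.
have -> : (k%:R + jac_exp l)^-1 = (alpha + k%:R + theta * l%:R + 1)^-1.
  by congr (_^-1); rewrite /jac_exp; ring.
apply: int01_ext (int01_powR e1) => t /andP[t0 _].
rewrite -!powR_mulrn ?powR_ge0 ?(ltW t0)// -powRrM.
rewrite -!powRD; try by rewrite (gt_eqF t0) implybT.
by congr powR; ring.
Qed.

Let int01_coef (P : 'I_N -> R) (Q : 'I_N -> R) :
  int01 (fun t => (\sum_l P l * (t `^ theta) ^+ l) * (\sum_k Q k * t ^+ k) *
    t `^ alpha)
    (\sum_l \sum_k P l * Q k / (k%:R + jac_exp l)).
Proof.
apply: (@int01_ext _ (fun t => \sum_l \sum_k P l * Q k *
  (t ^+ k * (t `^ theta) ^+ l * t `^ alpha))).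
  move=> t _; rewrite mulr_suml mulr_suml; apply: eq_bigr => l _.
  rewrite mulr_sumr mulr_suml; apply: eq_bigr => k _.
  by ring.
apply: int01_sum => l; apply: int01_sum => k.
by apply: int01Z; exact: int01_monomial.
Qed.

(** Only the moments of t occur in the integral, and summing them against one of
    the two coefficient matrices leaves a Kronecker delta. *)
Lemma jac_kernel_reproducing x y :
  int01 (fun t => jac_kernel x t * jac_kernel t y * t `^ alpha)
    (jac_kernel x y).
Proof.
pose P (l : 'I_N) := \sum_k jac_coef k l * x ^+ k.
pose Q (k : 'I_N) := \sum_l jac_coef k l * (y `^ theta) ^+ l.
have xP t : jac_kernel x t = \sum_l P l * (t `^ theta) ^+ l.
  rewrite /jac_kernel exchange_big; apply: eq_bigr => l _.
  by rewrite mulr_suml.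
have yQ t : jac_kernel t y = \sum_k Q k * t ^+ k.
  apply: eq_bigr => k _; rewrite mulr_suml; apply: eq_bigr => l _.
  by rewrite mulrAC.
have -> : jac_kernel x y = \sum_l \sum_k P l * Q k / (k%:R + jac_exp l).
  rewrite exchange_big/= yQ; apply: eq_bigr => k _.
  rewrite (_ : x ^+ k = \sum_l P l / (k%:R + jac_exp l)).
    by rewrite mulr_sumr; apply: eq_bigr => l _; ring.
  transitivity (\sum_(i < N) (i == k)%:R * x ^+ i).
    by rewrite (bigD1 k)//= eqxx mul1r big1 ?addr0// => i /negbTE->; rewrite mul0r.
  under eq_bigr => i _ do rewrite -sum_coef mulr_suml.
  rewrite exchange_big/=; apply: eq_bigr => l _.
  by rewrite mulr_suml; apply: eq_bigr => i _; rewrite mulrAC.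
apply: int01_ext (int01_coef P Q) => t _.
by rewrite xP yQ.
Qed.

Lemma jac_kernel_trace :
  int01 (fun t => jac_kernel t t * t `^ alpha) N%:R.
Proof.
have -> : N%:R = \sum_(k < N) \sum_(l < N) jac_coef k l / (k%:R + jac_exp l) :> R.
  under eq_bigr do rewrite sum_coef eqxx.
  by rewrite sumr_const card_ord.
apply: (@int01_ext _ (fun t => \sum_k \sum_l jac_coef k l *
  (t ^+ k * (t `^ theta) ^+ l * t `^ alpha))).
  move=> t _; rewrite mulr_suml; apply: eq_bigr => k _.
  by rewrite mulr_suml; apply: eq_bigr => l _; rewrite !mulrA.
apply: int01_sum => l; apply: int01_sum => k.
by apply: int01Z; exact: int01_monomial.
Qed.

Definition jac_kernel_mx n (x : seq R) : 'M[R]_n :=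
  \matrix_(i < n, j < n) jac_kernel x`_i x`_j.

(** Mehta's integration step.  Expanding the determinant along the new point, the
    diagonal entry contributes N det A by the trace, and the border contributes
    tr (adj A *m A) = n det A by the reproducing property. *)
Lemma int01_det_rcons n (x : seq R) : size x = n ->
  int01 (fun t => \det (jac_kernel_mx n.+1 (rcons x t)) * t `^ alpha)
    ((N%:R - n%:R) * \det (jac_kernel_mx n x)).
Proof.
move=> sx.
pose A := jac_kernel_mx n x.
have detE t : \det (jac_kernel_mx n.+1 (rcons x t)) = jac_kernel t t * \det A -
    \sum_(i < n) \sum_(j < n) \adj A i j *
       (jac_kernel x`_j t * jac_kernel t x`_i).
  have castE : jac_kernel_mx (n + 1) (rcons x t) = block_mx A
     (\col_j jac_kernel x`_j t) (\row_i jac_kernel t x`_i) (jac_kernel t t)%:M.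
    apply/matrixP => i j; rewrite mxE !nth_rcons sx.
    case: (split_ordP i) => i' ->; case: (split_ordP j) => j' ->;
      rewrite ?(block_mxEul, block_mxEur, block_mxEdl, block_mxEdr) !mxE /=;
      by rewrite ?ord1 ?addn0 ?ltn_ord ?ltnn ?eqxx.
  rewrite -addn1 castE det_bordered; congr (_ - _).
  rewrite mxE exchange_big /=; apply: eq_bigr => j _.
  rewrite !mxE mulr_suml; apply: eq_bigr => i _; rewrite !mxE; ring.
apply: (@int01_ext _ (fun t => \det A * (jac_kernel t t * t `^ alpha) +
    \sum_(i < n) \sum_(j < n) - \adj A i j *
       (jac_kernel x`_j t * jac_kernel t x`_i * t `^ alpha))).
  move=> t _; rewrite detE mulrBl [\det A * (_ * _)]mulrA [\det A * _]mulrC.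
  congr (_ + _).
  rewrite mulr_suml -sumrN; apply: eq_bigr => i _.
  by rewrite mulr_suml -sumrN; apply: eq_bigr => j _; ring.
have -> : (N%:R - n%:R) * \det A = \det A * N%:R +
    \sum_(i < n) \sum_(j < n) - \adj A i j * jac_kernel x`_j x`_i.
  have : \tr (\adj A *m A) = n%:R * \det A.
    by rewrite mul_adj_mx mxtrace_scalar mulr_natl.
  rewrite mulrBl => <-; congr (_ + _); first exact: mulrC.
  rewrite /mxtrace -sumrN; apply: eq_bigr => i _.
  by rewrite !mxE -sumrN; apply: eq_bigr => j _; rewrite !mxE mulNr.
apply: int01D; first exact/int01Z/jac_kernel_trace.
apply: int01_sum => i; apply: int01_sum => j; apply: int01Z.
exact: jac_kernel_reproducing.
Qed.

(** The signs of the two Vandermonde determinants cancel. *)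
Let weight_det (x : seq R) :
  jac_weight alpha theta N x =
    \prod_(i < N) x`_i `^ alpha * (\det (jac_kernel_mx N x) / \det Cmx).
Proof.
pose V := Vandermonde N (\row_(i < N) x`_i).
pose W := Vandermonde N (\row_(i < N) x`_i `^ theta).
have -> : jac_kernel_mx N x = V^T *m Cmx *m W.
  apply/matrixP => i j; rewrite !mxE /jac_kernel exchange_big/=.
  apply: eq_bigr => l _; rewrite !mxE mulr_suml; apply: eq_bigr => k _.
  by rewrite !mxE [_ * x`_i ^+ k]mulrC.
rewrite !det_mulmx det_tr mulrAC mulfK// !det_Vandermonde -big_split/=.
congr (_ * _); apply: eq_bigr => i _; rewrite -big_split/=.
by apply: eq_bigr => j _; rewrite !mxE; ring.
Qed.

(** The outermost variable of cube_integral is the first coordinate after x, so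
    the induction extends x at its end.  The constant c lets the normalization be
    carried inside the iterated integral. *)
Lemma cube_integral_jac_weight c m n (x : seq R) : size x = n -> (n + m)%N = N ->
  cube_integral m (fun y => (c * jac_weight alpha theta N (x ++ y))%:E) =
  (c * (m`!%:R * (\prod_(i < n) x`_i `^ alpha) *
     (\det (jac_kernel_mx n x) / \det Cmx)))%:E.
Proof.
elim: m n x => [|m IH] n x sx nm.
  have -> : n = N by rewrite -nm addn0.
  by rewrite /= cats0 weight_det mul1r.
rewrite /=.
under eq_integral => t _.
  under eq_fun do rewrite -cat_rcons.
  rewrite (IH n.+1) ?size_rcons ?sx ?addSnnS//.
  over.
have := int01Z (c * (m`!%:R * \prod_(i < n) x`_i `^ alpha) / \det Cmx)
  (int01_det_rcons sx).
set v := (X in int01 _ X) => h.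
have -> : c * (m.+1`!%:R * \prod_(i < n) x`_i `^ alpha *
    (\det (jac_kernel_mx n x) / \det Cmx)) = v.
  have Nn : N%:R - n%:R = m.+1%:R :> R.
    by rewrite -nm natrD addrC addrA addNr add0r.
  by rewrite /v Nn factS natrM; ring.
have [] : int01 (fun t => c * (m`!%:R * \prod_(i < n.+1) (rcons x t)`_i `^ alpha *
    (\det (jac_kernel_mx n.+1 (rcons x t)) / \det Cmx))) v; last by [].
apply: int01_ext h => t _.
rewrite big_ord_recr/= nth_rcons sx ltnn eqxx.
under [in RHS]eq_bigr => i _ do rewrite nth_rcons sx ltn_ord.
by ring.
Qed.

Lemma jac_corrE n (x : n.-tuple R) : (n <= N)%N ->
  jac_corr alpha theta N x =
    \prod_(i < n) x`_i `^ alpha * \det (jac_kernel_mx n x).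
Proof.
move=> nN; rewrite /jac_corr.
have Z : jac_partition alpha theta N = N`!%:R / \det Cmx.
  rewrite /jac_partition.
  have := @cube_integral_jac_weight 1 N 0 [::] erefl (add0n N).
  rewrite big_ord0 det_mx00 mulr1 !mul1r.
  by under eq_fun do rewrite mul1r; move=> ->.
rewrite /jac_density Z (@cube_integral_jac_weight _ _ n) ?size_tuple ?subnKC//=.
have fN k : k`!%:R != 0 :> R by rewrite pnatr_eq0 -lt0n fact_gt0.
by field; rewrite !fN detC_neq0.
Qed.

End jacobi_correlation.

(** * Scaling limit of the kernel *)

Section kernel_scaling.
Context {R : realType}.
Variables (alpha theta : R).
Hypotheses (theta_gt0 : 0 < theta) (alpha_gtN1 : -1 < alpha).

Lemma prod_natr_sub (k M : nat) : (k <= M)%N ->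
  \prod_(m < M.+1 | m != k :> nat) (k%:R - m%:R : R) =
    (-1) ^+ (M - k) * (k`!%:R * (M - k)`!%:R).
Proof.
move=> /subnKC <-; rewrite addKn; elim: (M - k)%N => [|d IH].
  rewrite addn0 big_mkcond big_ord_recr/= eqxx mulr1 expr0 !mul1r mulr1.
  rewrite -ffactnn ffact_prod natr_prod; apply: eq_bigr => i _.
  by rewrite (ltn_eqF (ltn_ord i))/= natrB// ltnW.
rewrite addnS big_mkcond big_ord_recr/= -big_mkcond IH/=.
rewrite gtn_eqF ?ltnS ?leq_addr//= exprS factS natrM -addnS natrD.
by ring.
Qed.

Lemma prod_scaled_shift (a b : R) (k M : nat) : 0 < b ->
  \prod_(m < M.+1) (a + k%:R + b * m%:R) =
    b ^+ M.+1 * euler_ratio (a / b + b^-1 * k%:R) M *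
     (M`!%:R * M.+1%:R `^ (a / b + b^-1 * k%:R)).
Proof.
move=> b0; rewrite /euler_ratio.
have d0 : M`!%:R * M.+1%:R `^ (a / b + b^-1 * k%:R) != 0 :> R.
  by rewrite mulf_neq0 ?gt_eqF ?powR_gt0// ltr0n fact_gt0.
rewrite -mulrA divfK// -[X in b ^+ X](card_ord M.+1) -prodr_const -big_split/=.
by apply: eq_bigr => m _; field; rewrite gt_eqF.
Qed.

(** With N = M + 1, the products over a_k + b_m and a_m + b_l are Euler products
    and those over differences are factorials.  The signs (-1)^(M - k) and
    (-1)^(M - l) reduce to (-1)^(k + l), and theta^(M + 1) / theta^M leaves theta. *)
Lemma jac_coefE M (k l : 'I_M.+1) :
  jac_coef alpha theta k l = (-1) ^+ k / k`!%:R * ((-1) ^+ l / l`!%:R) *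
   (theta / (alpha + 1 + k%:R + theta * l%:R)) *
   (euler_ratio ((alpha + 1) / theta + theta^-1 * k%:R) M *
     M.+1%:R `^ ((alpha + 1) / theta + theta^-1 * k%:R) * (M ^_ k)%:R) *
   (euler_ratio (alpha + 1 + theta * l%:R) M *
     M.+1%:R `^ (alpha + 1 + theta * l%:R) * (M ^_ l)%:R).
Proof.
rewrite /jac_coef /cauchy_inv.
have kM : (k <= M)%N by rewrite -ltnS ltn_ord.
have lM : (l <= M)%N by rewrite -ltnS ltn_ord.
rewrite (prod_natr_sub kM).
have -> : \prod_(m < M.+1) (k%:R + jac_exp alpha theta m) =
    \prod_(m < M.+1) (alpha + 1 + k%:R + theta * m%:R).
  by apply: eq_bigr => m _; rewrite /jac_exp; ring.
rewrite prod_scaled_shift//.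
have -> : \prod_(m < M.+1) (m%:R + jac_exp alpha theta l) =
    euler_ratio (alpha + 1 + theta * l%:R) M *
     (M`!%:R * M.+1%:R `^ (alpha + 1 + theta * l%:R)).
  rewrite /euler_ratio divfK; last first.
    by rewrite mulf_neq0 ?gt_eqF ?powR_gt0// ltr0n fact_gt0.
  by apply: eq_bigr => m _; rewrite addrC.
have -> : \prod_(m < M.+1 | m != l) (jac_exp alpha theta l - jac_exp alpha theta m) =
   theta ^+ M * ((-1) ^+ (M - l) * (l`!%:R * (M - l)`!%:R)).
  rewrite -(prod_natr_sub lM).
  rewrite -[X in theta ^+ X]/(M.+1.-1) -[in theta ^+ _](card_ord M.+1) -(cardC1 l).
  rewrite -prodr_const -big_split/=; apply: eq_bigr => m _.
  by rewrite /jac_exp; ring.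
have fact_ffact i : (i <= M)%N -> (M`!%:R : R) = (M ^_ i)%:R * (M - i)`!%:R.
  by move=> iM; rewrite -natrM ffact_fact.
have fN i : i`!%:R != 0 :> R by rewrite pnatr_eq0 -lt0n fact_gt0.
have sgn i : (i <= M)%N -> (-1) ^+ (M - i) = (-1) ^+ M * (-1) ^+ i :> R.
  by move=> iM; rewrite -signr_odd oddB// signr_addb !signr_odd.
have ek i : (i <= M)%N -> M`!%:R / ((-1) ^+ (M - i) * (i`!%:R * (M - i)`!%:R)) =
    (-1) ^+ M * ((-1) ^+ i / i`!%:R * (M ^_ i)%:R) :> R.
  move=> iM; rewrite (fact_ffact i iM) invfM invr_sign sgn//.
  by field; rewrite !fN.
have sg2 : (-1) ^+ M * (-1) ^+ M = 1 :> R.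
  by rewrite -exprD addnn -signr_odd odd_double.
have den : k%:R + jac_exp alpha theta l = alpha + 1 + k%:R + theta * l%:R.
  by rewrite /jac_exp; ring.
have den0 : alpha + 1 + k%:R + theta * l%:R != 0.
  rewrite gt_eqF// -addrA ltr_pwDl ?addr_ge0 ?mulr_ge0 ?(ltW theta_gt0)//.
  by rewrite -ltrBlDr sub0r.
have th0 : theta != 0 by rewrite gt_eqF.
rewrite den.
set Ek := euler_ratio _ _; set El := euler_ratio (_ + _ * l%:R) _.
set Pk := _ `^ _; set Pl := _ `^ (_ + _ * l%:R).
set D := _ + theta * _ in den0 *.
rewrite [LHS](_ : _ = (M`!%:R / ((-1) ^+ (M - k) * (k`!%:R * (M - k)`!%:R))) *
  (M`!%:R / ((-1) ^+ (M - l) * (l`!%:R * (M - l)`!%:R))) *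
  (theta / D) * (Ek * Pk) * (El * Pl)); last first.
  rewrite exprS; field.
  by rewrite ?fN ?th0 ?den0 ?signr_eq0 ?expf_neq0.
rewrite !ek// -[RHS]mul1r -[X in _ = X * _]sg2.
by ring.
Qed.

(** The powers of N = M + 1 cancel exactly:
    (alpha + 1 + k) / theta + (alpha + 1 + theta l) + k + l
    = p (alpha + 1 + k + theta l), where N^k and N^l come from the falling
    factorials. *)
Lemma jac_kernel_scaled M (x y : R) : 0 < x -> 0 < y ->
  let p := 1 + theta^-1 in
  (M.+1%:R `^ (p * (alpha + 1)))^-1 *
    jac_kernel alpha theta M.+1 (x / M.+1%:R `^ p) (y / M.+1%:R `^ p) =
  \sum_(k < M.+1) \sum_(l < M.+1)
     wright_approx M ((alpha + 1) / theta) theta^-1 x k *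
     wright_approx M (alpha + 1) theta (y `^ theta) l *
     (theta / (alpha + 1 + k%:R + theta * l%:R)).
Proof.
move=> x0 y0 p; rewrite mulr_sumr; apply: eq_bigr => k _.
rewrite mulr_sumr; apply: eq_bigr => l _; rewrite jac_coefE.
set N : R := M.+1%:R; have N0 : 0 < N by [].
set sk := (alpha + 1) / theta + theta^-1 * k%:R.
set el := alpha + 1 + theta * l%:R.
have Npos r : N `^ r != 0 by rewrite gt_eqF// powR_gt0.
have ND r s : N `^ (r + s) = N `^ r * N `^ s.
  by rewrite powRD// (gt_eqF N0) implybT.
have xk : (x / N `^ p) ^+ k = x ^+ k / N `^ (p * k%:R).
  by rewrite expr_div_n powRrM powR_mulrn ?powR_ge0.
have yl : ((y / N `^ p) `^ theta) ^+ l = (y `^ theta) ^+ l / N `^ (p * theta * l%:R).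
  rewrite powRM ?invr_ge0 ?powR_ge0 ?(ltW y0)// exprMn; congr (_ * _).
  rewrite -powR_inv1 ?powR_ge0// -!powRrM -powR_mulrn ?powR_ge0// -powRrM.
  rewrite -[RHS]powR_inv1 ?powR_ge0// -powRrM; congr powR; ring.
have expo : N `^ sk * N `^ el * (N ^+ k * N ^+ l) =
   N `^ (p * (alpha + 1)) * N `^ (p * k%:R) * N `^ (p * theta * l%:R).
  rewrite -!powR_mulrn ?(ltW N0)// -!ND; congr powR; rewrite /sk /el /p; field.
  by rewrite gt_eqF.
have nk i : N ^+ i != 0 by rewrite expf_neq0// gt_eqF.
have fN i : i`!%:R != 0 :> R by rewrite pnatr_eq0 -lt0n fact_gt0.
rewrite xk yl /wright_approx -/sk -/el /ffact_ratio -/N.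
move: (Npos (p * (alpha + 1))) (Npos (p * k%:R)) (Npos (p * theta * l%:R)) expo.
rewrite (exprNn x) (exprNn (y `^ theta)).
move: (N `^ sk) (N `^ el) (N `^ (p * (alpha + 1))) (N `^ (p * k%:R))
  (N `^ (p * theta * l%:R)) => A B C Dk Dl C0 Dk0 Dl0 expo.
set Ek := euler_ratio sk M; set El := euler_ratio el M.
set w := theta / _.
have {expo} AB : A * B / (C * Dk * Dl) = (N ^+ k * N ^+ l)^-1.
  apply: (mulIf (mulf_neq0 (nk k) (nk l))).
  by rewrite mulrAC expo divff ?mulVf ?mulf_neq0.
transitivity ((-1) ^+ k / k`!%:R * ((-1) ^+ l / l`!%:R) * w * (Ek * (M ^_ k)%:R) *
   (El * (M ^_ l)%:R) * x ^+ k * (y `^ theta) ^+ l * (A * B / (C * Dk * Dl))).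
  by field; rewrite ?C0 ?Dk0 ?Dl0 ?fN.
by rewrite AB; field; rewrite ?nk ?fN.
Qed.

(** The double series is dominated termwise by the product of these two series;
    theta / (alpha + 1) bounds the coupling factor
    theta / (alpha + 1 + k + theta l). *)
Let dom_x (x : R) := wright_dom ((alpha + 1) / theta) theta^-1 x.
Let dom_y (y : R) l :=
  theta / (alpha + 1) * wright_dom (alpha + 1) theta (y `^ theta) l.

Let alpha1_gt0 : 0 < alpha + 1.
Proof. by rewrite -ltrBlDr sub0r. Qed.

Let alpha1_div_gt0 : 0 < (alpha + 1) / theta.
Proof. by rewrite divr_gt0. Qed.

Let thetaV_ge0 : 0 <= theta^-1.
Proof. by rewrite invr_ge0 ltW. Qed.

Let theta_ge0 : 0 <= theta.
Proof. exact: ltW. Qed.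

Let cvg_dom_y y : cvgn (series (dom_y y)).
Proof. by apply: is_cvg_seriesZ; exact: cvg_wright_dom. Qed.

Let dom_x_ge0 x k : 0 < x -> 0 <= dom_x x k.
Proof. by move=> x0; apply: wright_dom_ge0; exact: ltW. Qed.

Let dom_y_ge0 y l : 0 <= dom_y y l.
Proof.
by rewrite mulr_ge0 ?divr_ge0 ?(ltW alpha1_gt0)// wright_dom_ge0 ?powR_ge0.
Qed.

Let denom_le (k l : nat) :
  0 <= theta / (alpha + 1 + k%:R + theta * l%:R) <= theta / (alpha + 1).
Proof.
have d0 : 0 < alpha + 1 + k%:R + theta * l%:R.
  by rewrite -addrA ltr_pwDl// addr_ge0// mulr_ge0.
rewrite divr_ge0 ?(ltW d0)//= ler_wpM2l// lef_pV2 ?posrE//.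
by rewrite -addrA lerDl addr_ge0// mulr_ge0.
Qed.

Let dominated (x y u v : R) (k l : nat) : 0 < x -> 0 < y ->
  `|u| <= wright_dom ((alpha + 1) / theta) theta^-1 `|x| k ->
  `|v| <= wright_dom (alpha + 1) theta `|y `^ theta| l ->
  `|u * v * (theta / (alpha + 1 + k%:R + theta * l%:R))| <= dom_x x k * dom_y y l.
Proof.
move=> x0 y0; rewrite (gtr0_norm x0) (gtr0_norm (powR_gt0 theta y0)) => ug vh.
have /andP[w0 w1] := denom_le k l.
rewrite 2!normrM (ger0_norm w0) /dom_y [theta / _ * wright_dom _ _ _ _]mulrC.
rewrite [leRHS]mulrA.
have uv0 : 0 <= `|u| * `|v| by rewrite mulr_ge0.
have uv : `|u| * `|v| <= dom_x x k * wright_dom (alpha + 1) theta (y `^ theta) l.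
  exact: ler_pM.
exact: ler_pM.
Qed.

Lemma kernel_termE (x y : R) k l : kernel_term alpha theta x y k l =
  wright_coef ((alpha + 1) / theta) theta^-1 x k *
  wright_coef (alpha + 1) theta (y `^ theta) l *
  (theta / (alpha + 1 + k%:R + theta * l%:R)).
Proof.
rewrite /kernel_term /wright_coef -!exprNn powRrM powR_mulrn ?powR_ge0//.
by rewrite -(exprNn (y `^ theta)) [(_ + k%:R) / theta]mulrDl [k%:R / theta]mulrC.
Qed.

Let kernel_term_le x y k l : 0 < x -> 0 < y ->
  `|kernel_term alpha theta x y k l| <= dom_x x k * dom_y y l.
Proof.
by move=> x0 y0; rewrite kernel_termE; apply: dominated => //; exact: wright_coef_le.
Qed.

Lemma cvg_jac_kernel_scaled (x y : R) : 0 < x -> 0 < y ->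
  let p := 1 + theta^-1 in
  (M.+1%:R `^ (p * (alpha + 1)))^-1 *
    jac_kernel alpha theta M.+1 (x / M.+1%:R `^ p) (y / M.+1%:R `^ p)
  @[M --> \oo] --> limit_kernel alpha theta x y.
Proof.
move=> x0 y0 p; under eq_fun do rewrite jac_kernel_scaled//.
apply: (@Tannery_double _ (fun M k l =>
     wright_approx M ((alpha + 1) / theta) theta^-1 x k *
     wright_approx M (alpha + 1) theta (y `^ theta) l *
     (theta / (alpha + 1 + k%:R + theta * l%:R))) _ (dom_x x) (dom_y y)).
- move=> k l; rewrite kernel_termE; apply: cvgMl.
  by apply: cvgM; exact: cvg_wright_approx.
- by move=> k; exact: dom_x_ge0.
- exact: dom_y_ge0.
- by move=> M k l; apply: dominated => //; exact: wright_approx_le.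
- exact: cvg_wright_dom.
- exact: cvg_dom_y.
Qed.

(** A constant family in the double Tannery theorem: the iterated sum is also the
    limit of the square partial sums. *)
Lemma cvg_kernel_square (x y : R) : 0 < x -> 0 < y ->
  \sum_(k < n.+1) \sum_(l < n.+1) kernel_term alpha theta x y k l
  @[n --> \oo] --> limit_kernel alpha theta x y.
Proof.
move=> x0 y0.
apply: (@Tannery_double _ (fun _ => kernel_term alpha theta x y) _
  (dom_x x) (dom_y y)).
- by move=> k l; exact: cvg_cst.
- by move=> k; exact: dom_x_ge0.
- exact: dom_y_ge0.
- by move=> M k l; exact: kernel_term_le.
- exact: cvg_wright_dom.
- exact: cvg_dom_y.
Qed.

Let sum_le_series (f : nat -> R) n : (forall k, 0 <= f k) -> cvgn (series f) ->
  \sum_(0 <= k < n) f k <= limn (series f).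
Proof.
move=> f0 cf; apply: nondecreasing_cvgn_le => //.
by apply: nondecreasing_series => k _ _; exact: f0.
Qed.

Let esum_le_series (f : nat -> \bar R) (g : nat -> R) :
  (forall k, 0 <= f k <= (g k)%:E)%E -> cvgn (series g) ->
  (\esum_(k in [set: nat]) f k <= (limn (series g))%:E)%E.
Proof.
move=> fg cg; have f0 k : (0 <= f k)%E by case/andP: (fg k).
have g0 k : 0 <= g k by rewrite -lee_fin; case/andP: (fg k) => /le_trans; apply.
rewrite -nneseries_esumT//; apply: lime_le; first exact: is_cvg_nneseries.
apply: nearW => n; apply: (@le_trans _ _ (\sum_(0 <= k < n) g k)%:E).
  by rewrite -sumEFin; apply: lee_sum => k _; case/andP: (fg k).
by rewrite lee_fin; exact: sum_le_series.
Qed.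

Lemma summable_kernel_term (x y : R) : 0 < x -> 0 < y ->
  summable [set: nat * nat]
    (fun kl => (kernel_term alpha theta x y kl.1 kl.2)%:E).
Proof.
move=> x0 y0; rewrite /summable.
have -> : [set: nat * nat] = [set: nat] `*`` (fun=> [set: nat]).
  by apply/seteqP; split.
have kge0 (k l : nat) : setT k -> setT l ->
    (0 <= `|(kernel_term alpha theta x y k l)%:E|)%E by rewrite abse_ge0.
rewrite -(esum_esum kge0).
apply: (@le_lt_trans _ _
    (limn (series (fun k => limn (series (dom_y y)) * dom_x x k)))%:E);
  last exact: ltry.
apply: esum_le_series => [k|]; last by apply: is_cvg_seriesZ; exact: cvg_wright_dom.
rewrite esum_ge0//=.
rewrite mulrC -[X in (_ <= X%:E)%E](@lim_seriesZ _ _ (dom_x x k))//.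
apply: esum_le_series => [l|]; last exact: is_cvg_seriesZ.
by rewrite /= !lee_fin normr_ge0/= kernel_term_le.
Qed.

(** The square partial sum of the double series is theta times the integral of
    the product of the two partial sums of the Wright series, because
    1 / (alpha + 1 + k + theta l) is the integral of t^(k + theta l) t^alpha.  On
    (0, 1) these products are dominated by a constant times t^alpha. *)
Lemma limit_kernel_integral (x y : R) : 0 < x -> 0 < y ->
  ((limit_kernel alpha theta x y)%:E =
    (theta%:E * \int[lebesgue_measure]_(t in `]0%R, 1%R[)
        (wrightJ ((alpha + 1) / theta) theta^-1 (x * t) *
         wrightJ (alpha + 1) theta ((y * t) `^ theta) *
         t `^ alpha)%:E))%E.
Proof.
move=> x0 y0.
pose cx := wright_coef ((alpha + 1) / theta) theta^-1.
pose cy := wright_coef (alpha + 1) theta.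
pose f n t := (\sum_(k < n.+1) cx (x * t) k) *
  (\sum_(l < n.+1) cy ((y * t) `^ theta) l) * t `^ alpha.
have int_f n : int01 (f n)
  (theta^-1 * \sum_(k < n.+1) \sum_(l < n.+1) kernel_term alpha theta x y k l).
  rewrite mulr_sumr; under eq_bigr do rewrite mulr_sumr.
  apply: (@int01_ext _ (fun t => \sum_(k < n.+1) \sum_(l < n.+1)
    cx x k * cy (y `^ theta) l *
      (t ^+ k * (t `^ theta) ^+ l * t `^ alpha))).
    move=> t /andP[t0 _]; rewrite /f mulr_suml mulr_suml.
    apply: eq_bigr => k _; rewrite mulr_sumr mulr_suml; apply: eq_bigr => l _.
    rewrite /cx /cy /wright_coef powRM ?(ltW y0) ?(ltW t0)//.
    rewrite -(mulNr x) -(mulNr (y `^ theta)) !exprMn.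
    move: (_ / _ + _ * k%:R) (_ + _ * l%:R) => sk sl.
    move: (k`!%:R * Gamma sk)^-1 (l`!%:R * Gamma sl)^-1 => ck cl.
    by ring.
  apply: int01_sum => k; apply: int01_sum => l.
  have -> : theta^-1 * kernel_term alpha theta x y k l =
      cx x k * cy (y `^ theta) l * (k%:R + jac_exp alpha theta l)^-1.
    rewrite kernel_termE -/cx -/cy.
    rewrite (_ : k%:R + jac_exp alpha theta l = alpha + 1 + k%:R + theta * l%:R).
      by rewrite mulrCA mulKf ?gt_eqF.
    by rewrite /jac_exp; ring.
  by apply: int01Z; exact: int01_monomial.
have cf t : 0 < t < 1 -> f n t @[n --> \oo] -->
    wrightJ ((alpha + 1) / theta) theta^-1 (x * t) *
         wrightJ (alpha + 1) theta ((y * t) `^ theta) *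
         t `^ alpha.
  by move=> t01; apply: cvgMl; apply: cvgM; exact: cvg_wrightJ.
pose G := limn (series (dom_x x)).
pose H := limn (series (wright_dom (alpha + 1) theta (y `^ theta))).
have fle n t : 0 < t < 1 -> `|f n t| <= G * H * t `^ alpha.
  move=> /andP[t0 t1].
  rewrite /f 2!normrM (ger0_norm (powR_ge0 _ _)) ler_wpM2r ?powR_ge0//.
  apply: ler_pM => //; apply: sum_wright_coef_le => //.
    by rewrite gtr0_norm ?mulr_gt0// ger_pMr// ltW.
  rewrite ger0_norm ?powR_ge0// ge0_ler_powR ?nnegrE ?mulr_ge0 ?(ltW y0) ?(ltW t0)//.
  by rewrite ger_pMr// ltW.
have mf n : measurable_fun (`]0%R, 1%R[ : set R) (EFin \o f n).
  by have [/integrableP[]] := int_f n.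
pose F t := wrightJ ((alpha + 1) / theta) theta^-1 (x * t) *
         wrightJ (alpha + 1) theta ((y * t) `^ theta) * t `^ alpha.
have cfE t : `]0%R, 1%R[%classic t -> (f n t)%:E @[n --> \oo] --> (F t)%:E.
  rewrite /= in_itv/= => t01; apply: cvg_EFin; first exact: nearW.
  exact: cf.
have mF : measurable_fun (`]0%R, 1%R[ : set R) (EFin \o F).
  by apply: (emeasurable_fun_cvg (fun n => EFin \o f n)) => //.
have iG : lebesgue_measure.-integrable (`]0%R, 1%R[ : set R)
    (EFin \o (fun t => G * H * t `^ alpha)).
  by have [] := int01Z (G * H) (int01_powR alpha_gtN1).
have [] := @dominated_convergence _ _ R lebesgue_measure `]0%R, 1%R[%classic
  (measurable_itv _) (fun n => EFin \o f n) (EFin \o F) _ mf mF _ iG.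
- by apply: aeW => t; exact: cfE.
- apply: aeW => t n /=; rewrite in_itv/= => t01.
  by rewrite lee_fin; exact: fle.
move=> _ _ cint.
have cint2 : (theta^-1 * \sum_(k < n.+1) \sum_(l < n.+1)
    kernel_term alpha theta x y k l)%:E @[n --> \oo] -->
    (theta^-1 * limit_kernel alpha theta x y)%:E.
  apply: cvg_EFin; first exact: nearW.
  by apply: cvgMr; exact: cvg_kernel_square.
have -> : (\int[lebesgue_measure]_(t in `]0%R, 1%R[) (F t)%:E =
    (theta^-1 * limit_kernel alpha theta x y)%:E)%E.
  rewrite -(cvg_lim (@ereal_hausdorff R) cint2).
  apply/esym/cvg_lim => //.
  rewrite (_ : (fun n => _) = (fun n =>
    \int[lebesgue_measure]_(t in `]0%R, 1%R[) (f n t)%:E)%E)//.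
  by apply/funext => n; have [_ ->] := int_f n.
by rewrite -EFinM mulrA divff ?mul1r// gt_eqF.
Qed.

End kernel_scaling.

(** * Scaling limit of the correlation functions *)

Lemma cvg_det (R : realType) (n : nat) (A : nat -> 'M[R]_n) (B : 'M[R]_n) :
  (forall i j, A N i j @[N --> \oo] --> B i j) ->
  \det (A N) @[N --> \oo] --> \det B.
Proof.
move=> AB; apply: cvg_bigsum => s _; apply: cvgMr.
by apply: cvg_bigprod => i _; exact: AB.
Qed.

(** With N = M + 1, the monomial weight contributes N^(- p alpha n); together with
    the prefactor N^(- n p) this puts N^(- p (alpha + 1)) into each of the n rows. *)
Lemma jac_corr_scaled (R : realType) (theta alpha : R) (n M : nat)
    (x : n.-tuple R) : 0 < theta -> -1 < alpha ->
  (forall i : 'I_n, 0 < tnth x i) -> (n <= M.+1)%N ->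
  let p := 1 + theta^-1 in
  (M.+1%:R `^ (n%:R * p))^-1 *
    jac_corr alpha theta M.+1 [tuple tnth x i / M.+1%:R `^ p | i < n] =
  (\prod_(i < n) tnth x i `^ alpha) *
    \det (\matrix_(i < n, j < n) ((M.+1%:R `^ (p * (alpha + 1)))^-1 *
       jac_kernel alpha theta M.+1 (tnth x i / M.+1%:R `^ p)
         (tnth x j / M.+1%:R `^ p))).
Proof.
move=> theta0 alpha1 x0 nM p; rewrite jac_corrE//.
set y := [tuple _ | i < n].
have yE (i : 'I_n) : y`_i = tnth x i / M.+1%:R `^ p.
  by rewrite -tnth_nth tnth_mktuple.
set N : R := M.+1%:R; have N0 : 0 < N by rewrite ltr0Sn.
have ND r s : N `^ (r + s) = N `^ r * N `^ s.
  by rewrite powRD// (gt_eqF N0) implybT.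
have Npos r : N `^ r != 0 by rewrite gt_eqF// powR_gt0.
have -> : \prod_(i < n) y`_i `^ alpha =
    (\prod_(i < n) tnth x i `^ alpha) * (N `^ (p * alpha))^-1 ^+ n.
  rewrite -[X in _ ^+ X]card_ord -prodr_const -big_split/=.
  apply: eq_bigr => i _; rewrite yE powRM ?invr_ge0 ?powR_ge0 ?(ltW (x0 i))//.
  congr (_ * _); rewrite -powR_inv1 ?powR_ge0// -!powRrM.
  by rewrite -[RHS]powR_inv1 ?powR_ge0// -powRrM; congr powR; ring.
have -> : (\matrix_(i < n, j < n) ((N `^ (p * (alpha + 1)))^-1 *
       jac_kernel alpha theta M.+1 (tnth x i / N `^ p) (tnth x j / N `^ p))) =
    (N `^ (p * (alpha + 1)))^-1 *: jac_kernel_mx alpha theta M.+1 n y.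
  by apply/matrixP => i j; rewrite !mxE !yE.
have key : (N `^ (p * (alpha + 1)))^-1 ^+ n =
    (N `^ (n%:R * p))^-1 * (N `^ (p * alpha))^-1 ^+ n.
  rewrite mulrDr mulr1 ND invfM exprMn mulrC; congr (_ * _).
  by rewrite exprVn -powR_mulrn ?powR_ge0// -powRrM mulrC.
by rewrite detZ key -!mulrA mulrCA.
Qed.

Theorem theorem3p4 (R : realType) (theta alpha : R)
    (theta_gt0 : 0 < theta) (alpha_gtN1 : -1 < alpha) :
  (forall (n : nat) (x : n.-tuple R), (0 < n)%N ->
     (forall i : 'I_n, 0 < tnth x i) ->
     (N%:R `^ (n%:R * (1 + theta^-1)))^-1 *
       jac_corr alpha theta N
         [tuple tnth x i / N%:R `^ (1 + theta^-1) | i < n]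
     @[N --> \oo] -->
     (\prod_(i < n) tnth x i `^ alpha) *
       \det (\matrix_(i < n, j < n)
               limit_kernel alpha theta (tnth x i) (tnth x j)))
  /\
  (forall x y : R, 0 < x -> 0 < y ->
     summable [set: nat * nat]
       (fun kl => (kernel_term alpha theta x y kl.1 kl.2)%:E) /\
     (limit_kernel alpha theta x y)%:E =
     (theta%:E * \int[lebesgue_measure]_(t in `]0%R, 1%R[)
        (wrightJ ((alpha + 1) / theta) theta^-1 (x * t) *
         wrightJ (alpha + 1) theta ((y * t) `^ theta) *
         t `^ alpha)%:E)%E).
Proof.
split=> [n x n0 x0|x y x0 y0]; last first.
  by split; [exact: summable_kernel_term|exact: limit_kernel_integral].
have h : (\prod_(i < n) tnth x i `^ alpha) *
    \det (\matrix_(i < n, j < n) ((M.+1%:R `^ ((1 + theta^-1) * (alpha + 1)))^-1 *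
       jac_kernel alpha theta M.+1 (tnth x i / M.+1%:R `^ (1 + theta^-1))
         (tnth x j / M.+1%:R `^ (1 + theta^-1)))) @[M --> \oo] -->
    (\prod_(i < n) tnth x i `^ alpha) *
       \det (\matrix_(i < n, j < n)
               limit_kernel alpha theta (tnth x i) (tnth x j)).
  apply: cvgMr; apply: cvg_det => i j; rewrite mxE; under eq_fun do rewrite mxE.
  exact: cvg_jac_kernel_scaled.
rewrite -cvg_shiftS /=; apply: cvg_trans h; apply: near_eq_cvg; near=> M.
have nM : (n <= M.+1)%N by apply: leqW; near: M; exact: nbhs_infty_ge.
apply: esym; exact: (jac_corr_scaled theta_gt0 alpha_gtN1 x0 nM).
Unshelve. all: by end_near. Qed.
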